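(* Let $\nu\in\nu_0+\mathbb{N}$, $n\in\mathbb{N}$ and $r,t\in\{1,\dots,N\}$. The matrix entries of the monic matrix valued Hermite type polynomials are given by $$\bigl(P_n^{(\alpha,\nu)}(x)\bigr)_{r,t}=\frac{\alpha_r}{2^n\alpha_t}\frac{1}{(r-1)!}\left(\prod_{k=0}^{n-1}\frac{1+\frac{c^{(\nu+k)}}{d^{(\nu+k)}}}{N-r+1+\frac{c^{(\nu+k)}}{d^{(\nu+k)}}}\right)$$ $$\times\sum_{s=t}^{\min(N,n+r)}\frac{i^{s-t}(N-s+1)_{s-1}}{(s-t)!}\;{}_3F_2\!\left(\begin{matrix}1-s,\ r-N,\ n+1+c^{(\nu)}/d^{(\nu)}\\ 1-N,\ 1+c^{(\nu)}/d^{(\nu)}\end{matrix};1\right)H_{n+r-s}(x)\,H_{s-t}(ix),$$ where an empty sum is $0$ and an empty product is $1$.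
   Context: $N\ge1$ is an integer, $\mathbb{N}=\{0,1,2,\dots\}$, $i=\sqrt{-1}$, $(a)_k=a(a+1)\cdots(a+k-1)$ is the Pochhammer symbol, and ${}_3F_2$ is the (here terminating) generalized hypergeometric series $\sum_{j\ge0}\frac{(a_1)_j(a_2)_j(a_3)_j}{(b_1)_j(b_2)_j\,j!}z^j$, where the sum runs over $0\le j\le \min(s-1,N-r)$. Scalars in matrix expressions denote multiples of the identity, and $^\ast$ is the conjugate transpose. $H_n$ are the Hermite polynomials defined by $\sum_{n\ge0}\frac{t^n}{n!}H_n(x)=e^{2xt-t^2}$. $L(x)$ is the lower triangular $N\times N$ matrix with $L(x)_{m,n}=\frac{H_{m-n}(x)}{(m-n)!}$ for $m\ge n$ and $0$ for $m<n$, $m,n\in\{1,\dots,N\}$. $\alpha_1,\dots,\alpha_N$ are non-zero real numbers with $\alpha_1=1$, $S^\alpha=\mathrm{diag}(\alpha_1,\dots,\alpha_N)$, $L^\alpha(x)=S^\alpha L(x)(S^\alpha)^{-1}$, $J=\mathrm{diag}(1,2,\dots,N)$. Fix $\nu_0$. For each $\nu\in\nu_0+\mathbb{N}$ let $\Delta^{(\nu)}=\mathrm{diag}(\delta_1^{(\nu)},\dots,\delta_N^{(\nu)})$ have positive diagonal entries and let $c^{(\nu)},d^{(\nu)}$ be positive reals. Standing assumptions: for all $\nu\in\nu_0+\mathbb{N}$, $$\Delta^{(\nu+1)}=(d^{(\nu)}J+c^{(\nu)})\Delta^{(\nu)},\qquad \frac{\alpha_{k+1}^2}{\alpha_k^2}=\frac{d^{(\nu)}k(N-k)}{2(d^{(\nu)}k+c^{(\nu)})}\frac{\delta_{k+1}^{(\nu)}}{\delta_k^{(\nu)}},\quad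 k=1,\dots,N-1.$$ The weight on $\mathbb{R}$ is $W^{(\alpha,\nu)}(x)=e^{-x^2}L^\alpha(x)\Delta^{(\nu)}L^\alpha(x)^\ast$, and $P_n^{(\alpha,\nu)}$ is the unique matrix polynomial of degree $n$ with leading coefficient the identity such that $\int_{\mathbb{R}}P_n^{(\alpha,\nu)}(x)W^{(\alpha,\nu)}(x)P_m^{(\alpha,\nu)}(x)^\ast dx=0$ for $n\neq m$. *)

(* Defs.v *)
From HB Require Import structures.
From mathcomp Require Export all_boot all_order all_algebra.
From mathcomp Require Export all_classical all_reals all_analysis.
From mathcomp.real_closed Require Export complex.
Set Implicit Arguments.
Unset Strict Implicit.
Unset Printing Implicit Defensive.
Export Order.TTheory GRing.Theory Num.Theory.
Export numFieldNormedType.Exports.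
Global Open Scope classical_set_scope.
Global Open Scope ring_scope.

(* Indices: the scalar sequences (alpha, delta) are functions on nat, used only
   at the indices 1, ..., N; the matrix entry with ordinal indices (i, j) is the
   entry (i.+1, j.+1) in the usual 1-based numbering. *)

Definition pochhammer (F : fieldType) (a : F) (k : nat) : F :=
  \prod_(0 <= l < k) (a + l%:R).

(* The 3F2 series summed over 0 <= j <= K. *)
Definition hyp3F2 (F : fieldType) (K : nat) (a1 a2 a3 b1 b2 z : F) : F :=
  \sum_(0 <= j < K.+1)
    (pochhammer a1 j * pochhammer a2 j * pochhammer a3 j)
    / (pochhammer b1 j * pochhammer b2 j * j`!%:R) * z ^+ j.

(* The formal power series exp(2xt - t^2) cut off after the K-th term of the
   exponential, as a polynomial in t over F[x]. *)
Definition hermite_gf (F : numFieldType) (K : nat) : {poly {poly F}} :=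
  \sum_(0 <= k < K.+1)
    (k`!%:R^-1)%:P *: ((2 *: 'X)%:P * 'X - 'X^2) ^+ k.

(* H_n / n! is the coefficient of t^n in exp(2xt - t^2). As 2xt - t^2 is
   divisible by t, the terms of order k > n of the exponential do not
   contribute to it (lemma hermite_gfE). *)
Definition hermite (F : numFieldType) (n : nat) : {poly F} :=
  n`!%:R *: (hermite_gf F n)`_n.

Lemma hermite_gfE (F : numFieldType) (n K : nat) : (n <= K)%N ->
  (hermite_gf F K)`_n = n`!%:R^-1 *: hermite F n.
Proof.
move=> nK; have fn0 : n`!%:R != 0 :> F by rewrite pnatr_eq0 -lt0n fact_gt0.
rewrite /hermite scalerA mulVf // scale1r /hermite_gf.
rewrite (big_cat_nat (n := n.+1)) //= coefD [X in _ + X](_ : _ = 0) ?addr0 //.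
rewrite coef_sum big_nat_cond big1 // => k /andP[/andP[nk _] _].
rewrite coefZ (_ : (2 *: 'X)%:P * 'X - 'X^2 = ((2 *: 'X)%:P - 'X) * 'X).
  by rewrite exprMn coefMXn nk mulr0.
by rewrite mulrBl expr2.
Qed.

Definition shifts (R : realType) (nu0 : R) : set R :=
  [set nu | exists k : nat, nu = nu0 + k%:R].

Section MatrixWeight.
Variables (R : realType) (N : nat).
Implicit Types (a alpha delta : nat -> R) (x : R).

Definition diagC a : 'M[R[i]]_N := diag_mx (\row_(j < N) (a j.+1)%:C%C).

Definition Jmx : 'M[R[i]]_N := diagC (fun k => k%:R).

Definition Lmx x : 'M[R[i]]_N :=
  \matrix_(m < N, n < N)
    if (n <= m)%N then (hermite R[i] (m - n)).[x%:C%C] / (m - n)`!%:R else 0.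

Definition Lalpha alpha x : 'M[R[i]]_N :=
  diagC alpha *m Lmx x *m invmx (diagC alpha).

Definition weight alpha delta x : 'M[R[i]]_N :=
  (expR (- x ^+ 2))%:C%C *:
    (Lalpha alpha x *m diagC delta *m (Lalpha alpha x) ^t*%sesqui).

(* Integral over the real line (Lebesgue measure), entry by entry, through the
   real and imaginary parts. *)
Definition integral_mx (F : R -> 'M[R[i]]_N) : 'M[R[i]]_N :=
  \matrix_(i, j)
    ((\int[@lebesgue_measure R]_x complex.Re (F x i j))
     +i* (\int[@lebesgue_measure R]_x complex.Im (F x i j)))%C.

(* A matrix polynomial is a matrix of polynomials; its coefficient of degree k
   is the matrix of the coefficients of degree k of the entries. *)
Definition coef_mx (P : 'M[{poly R[i]}]_N) (k : nat) : 'M[R[i]]_N :=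
  map_mx (fun p : {poly R[i]} => p`_k) P.

Definition eval_mx (P : 'M[{poly R[i]}]_N) (z : R[i]) : 'M[R[i]]_N :=
  map_mx (fun p : {poly R[i]} => p.[z]) P.

Definition monic_degree (P : 'M[{poly R[i]}]_N) (n : nat) : Prop :=
  coef_mx P n = 1%:M /\ (forall k : nat, (n < k)%N -> coef_mx P k = 0).

Definition monic_orthogonal (W : R -> 'M[R[i]]_N)
    (P : nat -> 'M[{poly R[i]}]_N) : Prop :=
  (forall n : nat, monic_degree (P n) n) /\
  (forall n m : nat, n <> m ->
     integral_mx (fun x => eval_mx (P n) x%:C%C *m W x
                           *m (eval_mx (P m) x%:C%C) ^t*%sesqui) = 0).

End MatrixWeight.

(* Main.v *)
From HB Require Import structures.
Require Import Defs.
From mathcomp Require Import measurable_realfun.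
From mathcomp Require Import ring lra zify.

(** Write kappa = c / d, p = N - 1, and index rows and columns from 0 (row q,
    columns s and t). The weight is exp(-x^2) S L T L^t S with S the diagonal
    matrix of the alphas, L lower triangular Toeplitz with entries
    h_k = H_k / k! and T_s = delta_s / alpha_s^2. So if P_n = S Q S^-1, the rows
    of F = Q L are orthogonal for the diagonal weight exp(-x^2) T, which suggests
    looking for F with entries f_s H_{n+q-s}: by the orthogonality of the
    Hermite polynomials, row q of degree n then only interacts with row q' of
    degree m when n + q = m + q'. Two things remain to be arranged: Q = F L^-1
    must be monic of degree n, and finitely many scalar sums over s must vanish.

    Monic. The inverse of L is Toeplitz in l_k = i^k H_k(i x) / k!. Since
    h_k' = 2 h_{k-1} and l_k' = - 2 l_{k-1}, differentiating a convolution
    sum_j phi(j) h_{K-j} l_j amounts, up to the factor 2, to replacing phi by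
    its difference phi(j) - phi(j+1) and K by K - 1 (deriv_hermite_conv). Hence if
    phi(s) = f_s (n+q-s)! is a polynomial of degree n in s, with n-th difference
    n! / 2^n, then Q is monic of degree n (coef_hermite_conv).

    Orthogonality. The 3F2 at 1 of the statement is a Hahn polynomial hahn(s),
    and it has two other forms, both instances of one transformation of
    terminating sums (hyp_sumE), which is Chu-Vandermonde used twice:
    - p^_s hahn(s) = (n+q)^_s hahn_dual(s), with falling factorials, where
      hahn_dual is a polynomial of degree n in s that vanishes for
      p < s <= n + q (hahn_duality, hahn_dual_eq0); this provides phi;
    - (1+kappa)_s / s! hahn(s), for s <= p, is the coefficient of z^s in
      (1 - z)^n g(z) with g of degree at most q (hahn_gfE).
    Summation by parts against (1 - z)^n takes an n-th difference, so the
    second form is orthogonal to the polynomials in s of degree m < n that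
    vanish for p < s <= n + q, in particular to the hahn_dual of a row of
    degree m with the same n + q (hahn_orthogonal). The recurrence of the
    alphas makes T_s the weight that turns the orthogonality of the rows into
    this statement (weight_ratioE).

    The explicit sequence is thus monic and orthogonal with invertible norms,
    and a monic orthogonal sequence is unique (monic_orthogonal_unique). The
    analysis needed is that p exp(-x^2) is integrable and that the integral of
    p' exp(-x^2) is that of 2 x p exp(-x^2) (gauss_int_deriv): the moments then
    satisfy the recurrence from which Hermite orthogonality follows
    algebraically. Finally, comparing the recurrence of the alphas at nu and
    nu + 1 gives kappa(nu + 1) = kappa(nu) + 1 as soon as N > 1 (kappa_step),
    so that the product in the statement is a quotient of Pochhammer
    symbols. *)

Set Implicit Arguments.
Unset Strict Implicit.
Unset Printing Implicit Defensive.

(** * Pochhammer symbols and finite differences *)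

Lemma sum_shift (V : nmodType) (t : nat -> V) k x : (k <= x)%N ->
  (forall i, (i < k)%N -> t i = 0) ->
  \sum_(j < x.+1) t j = \sum_(i < (x - k).+1) t (k + i)%N.
Proof.
move=> le_kx t0; rewrite -(big_mkord xpredT t).
rewrite -(big_mkord xpredT (fun i => t (k + i)%N)).
rewrite (@big_cat_nat _ _ _ k) //; last exact: leqW.
rewrite big_nat big1 => [/=|i /andP[_ lt_ik]]; last exact: t0.
rewrite add0r.
rewrite -{1}[k]add0n big_addn subSn //.
by apply: eq_big_nat => i _; rewrite addnC.
Qed.

Section Pochhammer.
Variable F : fieldType.
Implicit Types (a b d e : F) (u phi psi : nat -> F).

Lemma poch0 a : pochhammer a 0 = 1.
Proof. by rewrite /pochhammer big_nil. Qed.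

Lemma pochSr a k : pochhammer a k.+1 = pochhammer a k * (a + k%:R).
Proof. by rewrite /pochhammer big_nat_recr. Qed.

Lemma pochD a j k :
  pochhammer a (j + k) = pochhammer a j * pochhammer (a + j%:R) k.
Proof.
elim: k => [|k IH]; first by rewrite addn0 poch0 mulr1.
by rewrite addnS !pochSr IH natrD; ring.
Qed.

Lemma pochS a k : pochhammer a k.+1 = a * pochhammer (a + 1) k.
Proof. by rewrite -add1n pochD pochSr poch0 mul1r addr0. Qed.

Lemma poch_natN m k :
  pochhammer (- m%:R : F) k = (-1) ^+ k * (m ^_ k)%:R.
Proof.
elim: k => [|k IH]; first by rewrite poch0 expr0 mul1r ffactn0.
rewrite pochSr IH ffactnSr exprS natrM.
have [le_km|lt_mk] := leqP k m; first by rewrite natrB //; ring.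
by rewrite ffact_small // !(mulr0, mul0r).
Qed.

Lemma poch_ffact m s :
  pochhammer (m%:R + 1 : F) s = ((m + s) ^_ s)%:R.
Proof.
elim: s => [|s IH]; first by rewrite poch0 ffactn0.
rewrite pochSr IH addnS ffactSS natrM mulrC; congr (_ * _).
by rewrite -natr1 natrD; ring.
Qed.

(** The recursion common to all inductions on binomial sums below. *)
Lemma pascal_sum m u :
  \sum_(i < m.+2) 'C(m.+1, i)%:R * u i =
  \sum_(i < m.+1) 'C(m, i)%:R * u i + \sum_(i < m.+1) 'C(m, i)%:R * u i.+1.
Proof.
rewrite big_ord_recl /= bin0.
under eq_bigr => i _ do rewrite /bump /= add1n binS natrD mulrDl.
rewrite big_split /= addrA; congr (_ + _).
have -> : \sum_(i < m.+1) 'C(m, i)%:R * u i =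
          \sum_(i < m.+2) 'C(m, i)%:R * u i.
  by rewrite [RHS]big_ord_recr /= bin_small // mul0r addr0.
by rewrite [RHS]big_ord_recl bin0.
Qed.

(** Chu-Vandermonde, multiplied by (d)_m so that it holds for every a and d.
    By Pascal's rule the sum for m.+1 is (d + m) times the sum for (a, d) minus
    a times the sum for (a + 1, d + 1), and both depend on d - a only. *)
Lemma vandermonde m a d :
  \sum_(i < m.+1)
     'C(m, i)%:R * ((-1) ^+ i * pochhammer a i * pochhammer (d + i%:R) (m - i))
  = pochhammer (d - a) m.
Proof.
elim: m a d => [|m IH] a d.
  by rewrite big_ord_recl big_ord0 bin0 /= !poch0; ring.
rewrite (pascal_sum m (fun i => (-1) ^+ i * pochhammer a i
                                * pochhammer (d + i%:R) (m.+1 - i))).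
rewrite (eq_bigr (fun i : 'I_m.+1 => (d + m%:R) * ('C(m, i)%:R *
   ((-1) ^+ i * pochhammer a i * pochhammer (d + i%:R) (m - i))))); last first.
  move=> i _; have le_im : (i <= m)%N by rewrite -ltnS.
  by rewrite subSn // pochSr natrB //; ring.
rewrite -mulr_sumr IH.
rewrite (eq_bigr (fun i : 'I_m.+1 => (- a) * ('C(m, i)%:R *
   ((-1) ^+ i * pochhammer (a + 1) i
     * pochhammer (d + 1 + i%:R) (m - i))))); last first.
  move=> i _; rewrite subSS pochS exprS (_ : d + i.+1%:R = d + 1 + i%:R); first by ring.
  by rewrite -natr1; ring.
rewrite -mulr_sumr IH pochSr (_ : d + 1 - (a + 1) = d - a); ring.
Qed.

(** This is (d)_x times the terminating 3F2 with upper parameters -x, a, b and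
    lower parameters d, e at 1. Multiplying out (d)_x leaves a sum that makes
    sense when d is a nonpositive integer, even where the quotient has 0 in the
    denominator. *)
Definition hyp_sum a b d e x : F :=
  \sum_(j < x.+1) 'C(x, j)%:R *
    ((-1) ^+ j * pochhammer a j * pochhammer b j
     * pochhammer (d + j%:R) (x - j) / pochhammer e j).

Lemma hyp_sumC a b d e x : hyp_sum a b d e x = hyp_sum b a d e x.
Proof. by apply: eq_bigr => j _; rewrite (mulrAC _ (pochhammer a j)). Qed.

(** Expand (b)_j / (e)_j by Chu-Vandermonde into a sum over k and exchange the
    sums: the sum over j is again a Chu-Vandermonde sum, with value
    (d - a)_(x - k). *)
Lemma hyp_sumE a b d e x : (forall j, (j <= x)%N -> pochhammer e j != 0) ->
  hyp_sum a b d e x =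
  \sum_(k < x.+1) 'C(x, k)%:R *
    (pochhammer (e - b) k * pochhammer a k * pochhammer (d - a) (x - k)
     / pochhammer e k).
Proof.
move=> e_neq0.
pose t j k : F := 'C(x, j)%:R * 'C(j, k)%:R * ((-1) ^+ j * pochhammer a j
    * pochhammer (d + j%:R) (x - j)) * ((-1) ^+ k * pochhammer (e - b) k)
    / pochhammer e k.
transitivity (\sum_(j < x.+1) \sum_(k < x.+1) t j k).
  apply: eq_bigr => j _; have le_jx : (j <= x)%N by rewrite -ltnS.
  rewrite (_ : pochhammer b j = pochhammer (e - (e - b)) j); last first.
    by congr (pochhammer _ j); ring.
  rewrite -vandermonde.
  rewrite (big_ord_widen x.+1 (fun i => 'C(j, i)%:R * ((-1) ^+ i *
     pochhammer (e - b) i * pochhammer (e + i%:R) (j - i)))) ?ltnS //.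
  rewrite big_mkcond mulr_sumr mulr_suml mulr_suml mulr_sumr.
  apply: eq_bigr => k _; rewrite /t.
  case: ltnP => [|lt_jk]; last by rewrite (bin_small lt_jk) !(mulr0, mul0r).
  rewrite ltnS => le_kj.
  have ek : pochhammer e k != 0 by apply: e_neq0; apply: leq_trans le_jx.
  have ejk := pochD e k (j - k); rewrite subnKC // in ejk.
  have ej := e_neq0 _ le_jx; rewrite ejk in ej *.
  move: ej; rewrite mulf_eq0 negb_or => /andP[_ ej].
  by field; apply/andP.
rewrite exchange_big /=; apply: eq_bigr => k _.
have le_kx : (k <= x)%N by rewrite -ltnS.
have -> : \sum_(j < x.+1) t j k = \sum_(i < (x - k).+1) t (k + i)%N k.
  apply: (@sum_shift F (fun j => t j k) k x le_kx) => i lt_ik.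
  by rewrite /t (@bin_small i k) // !(mulr0, mul0r).
rewrite (_ : d - a = d + k%:R - (a + k%:R)); last by ring.
rewrite -(vandermonde (x - k) (a + k%:R)) !(mulr_sumr, mulr_suml).
apply: eq_bigr => i _.
have le_i : (i <= x - k)%N by rewrite -ltnS.
have le_kix : (k + i <= x)%N by lia.
(* trinomial revision; all binomials are replaced by factorials *)
have bb : 'C(x, k + i)%:R * 'C(k + i, k)%:R = 'C(x, k)%:R * 'C(x - k, i)%:R :> F.
  rewrite -!natrM; congr (_%:R).
  have f1 := bin_fact le_kix; have f2 := bin_fact le_kx.
  have f3 := bin_fact le_i; have f4 := bin_fact (leq_addr i k).
  rewrite addKn in f4; rewrite (_ : x - k - i = x - (k + i))%N in f3; last by lia.
  apply/eqP.
  rewrite -(eqn_pmul2r (fact_gt0 k)) -(eqn_pmul2r (fact_gt0 i)).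
  rewrite -(eqn_pmul2r (fact_gt0 (x - (k + i)))); apply/eqP.
  move: f1; rewrite -{1}f4 => f1; move: f2; rewrite -{1}f3 => f2.
  nia.
rewrite /t bb pochD natrD exprD addrA subnDA.
(* two factors (-1)^k remain, one from each use of Chu-Vandermonde *)
have sign2 : (-1) ^+ k * (-1) ^+ k = 1 :> F by rewrite -expr2 sqrr_sign.
rewrite -[RHS]mul1r -[X in _ = X * _]sign2; ring.
Qed.

(** The right-hand side of hyp_sumE is left unchanged by this change of
    parameters, up to the exchange of a and b. It is Euler's transformation of
    2F1 in terms of coefficients. *)
Lemma hyp_sum_euler a b d e x : (forall j, (j <= x)%N -> pochhammer e j != 0) ->
  hyp_sum a b d e x = hyp_sum (e - a) (e - b) (d + e - a - b) e x.
Proof.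
move=> e_neq0; rewrite hyp_sumE // [RHS]hyp_sumC hyp_sumE //.
apply: eq_bigr => k _.
have -> : e - (e - a) = a by ring.
have -> : d + e - a - b - (e - b) = d - a by ring.
by rewrite (mulrC (pochhammer a k)).
Qed.

(** The operator 1 - E, with E the shift, that is minus the forward difference. *)
Definition fdiff phi k : F := phi k - phi k.+1.

Lemma iter_fdiffE n phi k :
  iter n fdiff phi k = \sum_(i < n.+1) 'C(n, i)%:R * ((-1) ^+ i * phi (k + i)%N).
Proof.
elim: n k => [|n IH] k.
  by rewrite big_ord_recl big_ord0 bin0 addn0 /= addr0 !mul1r.
rewrite /= {1}/fdiff !IH (pascal_sum n (fun i => (-1) ^+ i * phi (k + i)%N)).
congr (_ + _); rewrite -sumrN; apply: eq_bigr => i _.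
by rewrite addSnnS exprS; ring.
Qed.

Lemma iter_fdiff_bin n j k :
  iter n fdiff (fun x => 'C(x, j)%:R) k =
  if (n <= j)%N then (-1) ^+ n * 'C(k, j - n)%:R else 0.
Proof.
elim: n k => [|n IH] k; first by rewrite leq0n subn0 mul1r.
rewrite /= {1}/fdiff !IH; have [le_nj|lt_jn] := leqP n j; last first.
  by rewrite subrr ifF //; lia.
have [->|lt_nj] : j = n \/ (n < j)%N by lia.
  by rewrite subnn !bin0 subrr ltnn.
rewrite lt_nj -[(j - n)%N]prednK ?subn_gt0 // -subnS binS natrD exprS; ring.
Qed.

Lemma iter_fdiff_sum n m (a : nat -> F) (phi : nat -> nat -> F) k :
  iter n fdiff (fun x => \sum_(j < m) a j * phi j x) k =
  \sum_(j < m) a j * iter n fdiff (phi j) k.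
Proof.
elim: n k => [|n IH] k //=; rewrite {1}/fdiff !IH -sumrB.
by apply: eq_bigr => j _; rewrite -mulrBr.
Qed.

End Pochhammer.

(** * Hahn sums and their duality *)

Section Terminating.
Variable F : numFieldType.
Implicit Types (a b d e : F).

Lemma poch_gt0 a k : 0 < a -> 0 < pochhammer a k.
Proof.
move=> a_gt0; elim: k => [|k IH]; first by rewrite poch0 ltr01.
by rewrite pochSr mulr_gt0 // ltr_wpDr.
Qed.

Lemma poch_natN_neq0 m k : (k <= m)%N -> pochhammer (- m%:R : F) k != 0.
Proof.
move=> le_km; rewrite poch_natN mulf_neq0 ?expf_neq0 ?oppr_eq0 ?oner_eq0 //.
by rewrite pnatr_eq0 -lt0n ffact_gt0.
Qed.

Lemma poch_natN_small m k : (m < k)%N -> pochhammer (- m%:R : F) k = 0.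
Proof. by move=> lt_mk; rewrite poch_natN ffact_small // mulr0. Qed.

(** The two upper parameters that are nonpositive integers make all further
    terms vanish, so the cutoff can be replaced by x alone. *)
Lemma hyp3F2E m x a b d e : a = - m%:R ->
  hyp3F2 (minn x m) (- x%:R) a b d e 1 =
  \sum_(j < x.+1) 'C(x, j)%:R *
    ((-1) ^+ j * pochhammer a j * pochhammer b j
     / (pochhammer d j * pochhammer e j)).
Proof.
move=> ->; rewrite /hyp3F2 big_mkord.
rewrite (big_ord_widen x.+1 (fun j => (pochhammer (- x%:R) j
   * pochhammer (- m%:R) j * pochhammer b j)
   / (pochhammer d j * pochhammer e j * j`!%:R) * 1 ^+ j)) ?ltnS ?geq_minl //.
rewrite big_mkcond; apply: eq_bigr => j _; have le_jx : (j <= x)%N by rewrite -ltnS.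
case: ltnP => [_|]; last first.
  rewrite gtn_min ltnNge le_jx /= => lt_mj.
  by rewrite poch_natN_small // !(mulr0, mul0r).
have fj : j`!%:R != 0 :> F by rewrite pnatr_eq0 -lt0n fact_gt0.
rewrite expr1n mulr1 poch_natN -bin_ffact natrM invfM.
by move: (_ * _)^-1 => w; field.
Qed.

Lemma hyp3F2_hyp_sum m x a b d e : a = - m%:R ->
  (forall j, (j <= x)%N -> pochhammer d j != 0) ->
  pochhammer d x * hyp3F2 (minn x m) (- x%:R) a b d e 1 = hyp_sum a b d e x.
Proof.
move=> a_m d_neq0; rewrite (hyp3F2E _ _ _ _ a_m) mulr_sumr.
apply: eq_bigr => j _; have le_jx : (j <= x)%N by rewrite -ltnS.
have dj := d_neq0 _ le_jx; rewrite -[in pochhammer d x](subnKC le_jx) pochD invfM.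
rewrite -[in RHS](mulfK dj (pochhammer (d + j%:R) (x - j))); ring.
Qed.

Lemma hyp3F2C K z a1 a2 a3 b1 b2 :
  hyp3F2 K a1 a2 a3 b1 b2 z = hyp3F2 K a1 a2 a3 b2 b1 z :> F.
Proof. by apply: eq_bigr => j _; rewrite (mulrC (pochhammer b1 j)). Qed.

End Terminating.

Section DualHahn.
Variables (F : numFieldType) (p : nat) (kappa : F).
Hypothesis kappa_gt0 : 0 < kappa.
Implicit Types (n q x j : nat).

(** The Hahn polynomial of degree p - q in x that carries row q of the
    matrix polynomial of degree n. *)
Definition hahn n q x : F :=
  hyp3F2 (minn x (p - q)) (- x%:R) (- (p - q)%:R) (n%:R + 1 + kappa)
    (- p%:R) (1 + kappa) 1.

(** The coefficients, in the basis of the binomials C(x, j), of the 3F2 with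
    upper parameters -x, -n, 1 + kappa + p - q and lower parameters -(n + q),
    1 + kappa. The binomial basis makes it a polynomial of degree n in x, and
    makes its differences explicit. *)
Definition hahn_dual_coef n q j : F :=
  (-1) ^+ j * pochhammer (- n%:R) j * pochhammer (1 + kappa + (p - q)%:R) j
  / (pochhammer (- (n + q)%:R) j * pochhammer (1 + kappa) j).

Definition hahn_dual n q x : F :=
  \sum_(j < n.+1) hahn_dual_coef n q j * 'C(x, j)%:R.

Lemma iter_fdiff_hahn_dual m n q k :
  iter m (@fdiff F) (hahn_dual n q) k =
  \sum_(j < n.+1) hahn_dual_coef n q j
    * (if (m <= j)%N then (-1) ^+ m * 'C(k, j - m)%:R else 0).
Proof.
rewrite (iter_fdiff_sum m n.+1 (hahn_dual_coef n q) (fun j x => 'C(x, j)%:R)).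
by apply: eq_bigr => j _; rewrite iter_fdiff_bin.
Qed.

Let poch_kappa j : pochhammer (1 + kappa) j != 0.
Proof. by rewrite gt_eqF // poch_gt0 // addr_gt0. Qed.

(** Euler's transformation maps the parameters of hahn to those of
    hahn_dual. *)
Lemma hahn_dual_hyp_sum n q x : (q <= p)%N -> (x <= n + q)%N ->
  pochhammer (- (n + q)%:R) x * hahn_dual n q x =
  hyp_sum (- (p - q)%:R) (n%:R + 1 + kappa) (- p%:R) (1 + kappa) x.
Proof.
move=> le_qp le_x; rewrite hyp_sum_euler //.
have -> : 1 + kappa - - (p - q)%:R = 1 + kappa + (p - q)%:R by ring.
have -> : 1 + kappa - (n%:R + 1 + kappa) = - n%:R by ring.
have -> : - p%:R + (1 + kappa) - - (p - q)%:R - (n%:R + 1 + kappa)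
          = - (n + q)%:R by rewrite natrB // natrD; ring.
rewrite hyp_sumC -(@hyp3F2_hyp_sum _ n) => [|//|j le_jx]; last first.
  by apply: poch_natN_neq0; apply: leq_trans le_x.
congr (_ * _); rewrite hyp3F2E // /hahn_dual.
pose u j := hahn_dual_coef n q j * 'C(x, j)%:R.
transitivity (\sum_(j < (n + x).+1) u j).
  rewrite (big_ord_widen (n + x).+1 u) ?ltnS ?leq_addr // big_mkcond.
  apply: eq_bigr => j _; case: ltnP => // lt_nj.
  by rewrite /u /hahn_dual_coef poch_natN_small // !(mulr0, mul0r).
symmetry; transitivity (\sum_(j < x.+1) u j).
  by apply: eq_bigr => j _; rewrite /u /hahn_dual_coef; ring.
rewrite (big_ord_widen (n + x).+1 u) ?ltnS ?leq_addl // big_mkcond.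
apply: eq_bigr => j _; case: ltnP => // lt_xj.
by rewrite /u bin_small // mulr0.
Qed.

(** Both sides are, up to a common sign, the two sides of
    hahn_dual_hyp_sum. *)
Lemma hahn_duality n q x : (q <= p)%N -> (x <= p)%N -> (x <= n + q)%N ->
  (p ^_ x)%:R * hahn n q x = ((n + q) ^_ x)%:R * hahn_dual n q x.
Proof.
move=> le_qp le_xp le_x; have := hahn_dual_hyp_sum le_qp le_x.
rewrite -(@hyp3F2_hyp_sum _ (p - q)) => [|//|j le_jx]; last first.
  by apply: poch_natN_neq0; apply: leq_trans le_xp.
rewrite -/(hahn n q x) !poch_natN -!mulrA => /(congr1 ( *%R ((-1) ^+ x))).
by rewrite !mulrA -!expr2 !sqrr_sign !mul1r.
Qed.

(** In hahn_dual_hyp_sum the terms with j > p - q vanish, and in the others the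
    factor (-p + j)_(x - j) contains 0, because j <= p < x. *)
Lemma hahn_dual_eq0 n q x : (q <= p)%N -> (p < x)%N -> (x <= n + q)%N ->
  hahn_dual n q x = 0.
Proof.
move=> le_qp lt_px le_x; have := hahn_dual_hyp_sum le_qp le_x.
rewrite [hyp_sum _ _ _ _ _]big1 => [/eqP|j _]; last first.
  have [le_j|lt_j] := leqP j (p - q); last first.
    by rewrite (poch_natN_small _ lt_j) !(mulr0, mul0r).
  have -> : - p%:R + j%:R = - (p - j)%:R :> F by rewrite natrB; [ring | lia].
  by rewrite (@poch_natN_small _ (p - j) (x - j)) ?(mulr0, mul0r) //; lia.
by rewrite mulf_eq0 (negPf (poch_natN_neq0 _ le_x)) => /eqP.
Qed.

Lemma fdiff_hahn_dual n q k :
  iter n (@fdiff F) (hahn_dual n q) k =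
  n`!%:R * q`!%:R / (n + q)`!%:R
  * (pochhammer (1 + kappa + (p - q)%:R) n / pochhammer (1 + kappa) n).
Proof.
rewrite iter_fdiff_hahn_dual big_ord_recr /= big1 ?add0r => [|j _]; last first.
  by rewrite ifF ?mulr0 // leqNgt ltn_ord.
rewrite leqnn subnn bin0 mulr1 /hahn_dual_coef !poch_natN ffactnn.
have -> : (n + q) ^_ n = ((n + q)`! %/ q`!)%N.
  by rewrite ffact_factd ?leq_addr // addKn.
have dv : (q`! %| (n + q)`!)%N.
  by rewrite -(@bin_fact (n + q) n) ?leq_addr // addKn !dvdn_mull.
have nq : (n + q)`!%:R != 0 :> F by rewrite pnatr_eq0 -lt0n fact_gt0.
have q0 : q`!%:R != 0 :> F by rewrite pnatr_eq0 -lt0n fact_gt0.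
rewrite natf_div //.
have s0 : (-1) ^+ n != 0 :> F by rewrite expf_neq0 // oppr_eq0 oner_eq0.
have s2 : (-1) ^+ n * (-1) ^+ n = 1 :> F by rewrite -expr2 sqrr_sign.
rewrite -[RHS]mul1r -[X in _ = X * _]s2.
by field; rewrite poch_kappa nq q0 s0.
Qed.

Lemma fdiff_hahn_dual0 m n q k : (m < n)%N ->
  iter n (@fdiff F) (hahn_dual m q) k = 0.
Proof.
move=> lt_mn; rewrite iter_fdiff_hahn_dual big1 // => j _.
by rewrite ifF ?mulr0 //; have := ltn_ord j; lia.
Qed.

(** The coefficients of the polynomial g of degree at most q such that
    (1 - z)^n g(z) agrees up to z^p with the generating function of
    (1 + kappa)_x / x! hahn(x). *)
Definition hahn_gf n q k : F :=
  pochhammer (- q%:R) k * pochhammer (n%:R + 1 + kappa) k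
  / (pochhammer (- p%:R) k * k`!%:R).

(** hyp_sumE with the roles of the two lower parameters exchanged: then e = -p,
    which is harmless for x <= p, and d - a = -n produces the coefficients of
    (1 - z)^n. *)
Lemma hahn_gfE n q x : (q <= p)%N -> (x <= p)%N ->
  pochhammer (1 + kappa) x / x`!%:R * hahn n q x =
  \sum_(k < x.+1) hahn_gf n q k * ((-1) ^+ (x - k) * 'C(n, x - k)%:R).
Proof.
move=> le_qp le_xp; rewrite /hahn hyp3F2C mulrAC.
rewrite hyp3F2_hyp_sum // hyp_sumC hyp_sumE => [|j le_jx]; last first.
  by apply: poch_natN_neq0; apply: leq_trans le_xp.
rewrite mulr_suml; apply: eq_bigr => k _; have le_kx : (k <= x)%N by rewrite -ltnS.
have -> : - p%:R - - (p - q)%:R = - q%:R :> F by rewrite natrB //; ring.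
have -> : 1 + kappa - (n%:R + 1 + kappa) = - n%:R by ring.
rewrite (poch_natN _ n) -bin_ffact natrM /hahn_gf.
have := bin_fact le_kx => /(congr1 (fun i => i%:R : F)); rewrite !natrM => <-.
have k0 : k`!%:R != 0 :> F by rewrite pnatr_eq0 -lt0n fact_gt0.
have xk0 : (x - k)`!%:R != 0 :> F by rewrite pnatr_eq0 -lt0n fact_gt0.
have b0 : 'C(x, k)%:R != 0 :> F by rewrite pnatr_eq0 -lt0n bin_gt0.
have p0 : pochhammer (- p%:R) k != 0 :> F.
  by apply: poch_natN_neq0; apply: leq_trans le_xp.
by field; rewrite k0 xk0 b0 p0.
Qed.

(** Summation by parts: pairing (1 - z)^n z^k with psi gives the n-th
    difference of psi at k. *)
Lemma hahn_gf_pairing n q (psi : nat -> F) :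
  (forall k, iter n (@fdiff F) psi k = 0) ->
  \sum_(x < (n + q).+1)
    (\sum_(k < x.+1) hahn_gf n q k * ((-1) ^+ (x - k) * 'C(n, x - k)%:R)) * psi x
  = 0.
Proof.
move=> psi0.
pose u x k := if (k <= x)%N then
  hahn_gf n q k * ((-1) ^+ (x - k) * 'C(n, x - k)%:R) * psi x else 0.
transitivity (\sum_(x < (n + q).+1) \sum_(k < (n + q).+1) u x k).
  apply: eq_bigr => x _; rewrite mulr_suml.
  rewrite (big_ord_widen (n + q).+1 (fun k => hahn_gf n q k *
    ((-1) ^+ (x - k) * 'C(n, x - k)%:R) * psi x)) ?ltn_ord // big_mkcond.
  by apply: eq_bigr => k _; rewrite /u ltnS.
rewrite exchange_big big1 //= => k _; have le_k : (k <= n + q)%N by rewrite -ltnS.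
have [le_kq|lt_qk] := leqP k q; last first.
  rewrite big1 // => x _; rewrite /u /hahn_gf (poch_natN_small _ lt_qk).
  by rewrite !mul0r if_same.
rewrite (@sum_shift F (u^~ k) k (n + q)) //; last first.
  by move=> i lt_ik; rewrite /u ifF //; lia.
rewrite -[RHS](mulr0 (hahn_gf n q k)) -[X in _ = _ * X](psi0 k) iter_fdiffE.
rewrite mulr_sumr.
pose v i := hahn_gf n q k * ('C(n, i)%:R * ((-1) ^+ i * psi (k + i)%N)).
transitivity (\sum_(i < (n + q - k).+1) v i).
  by apply: eq_bigr => i _; rewrite /u /v leq_addr addKn; ring.
have le_n : (n.+1 <= (n + q - k).+1)%N by lia.
rewrite -/(v _) (big_ord_widen _ v le_n) [RHS]big_mkcond.
apply: eq_bigr => i _; case: ltnP => // lt_ni.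
by rewrite /v bin_small // !(mulr0, mul0r).
Qed.

(** The factor in front of hahn_dual is a coefficient of (1 - z)^n g(z), and the
    sum can be extended to all x <= n + q because hahn_dual vanishes for x > p;
    it is then the complete pairing of hahn_gf_pairing, with a polynomial in x
    of degree m < n. *)
Lemma hahn_orthogonal n m q q' : (q <= p)%N -> (q' <= p)%N ->
  (m < n)%N -> (n + q = m + q')%N ->
  \sum_(x < p.+1 | (x <= n + q)%N)
     pochhammer (1 + kappa) x / x`!%:R * hahn n q x * hahn_dual m q' x = 0.
Proof.
move=> le_qp le_qp' lt_mn eq_M.
have psi0 k : iter n (@fdiff F) (hahn_dual m q') k = 0.
  exact: fdiff_hahn_dual0.
rewrite -[RHS](hahn_gf_pairing q psi0).
pose u (x : nat) : F := (\sum_(k < x.+1) hahn_gf n q k *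
   ((-1) ^+ (x - k) * 'C(n, x - k)%:R)) * hahn_dual m q' x.
(* K is a common bound for both ranges of summation *)
pose K := (p + (n + q)).+1.
transitivity (\sum_(x < K | (x <= p)%N && (x <= n + q)%N) u x).
  rewrite [RHS](eq_bigl (fun x : 'I_K => (x <= n + q)%N && (x < p.+1)%N)); last first.
    by move=> x; rewrite andbC ltnS.
  rewrite -(big_ord_widen_cond K (fun x => x <= n + q)%N u); last by rewrite /K; lia.
  apply: eq_bigr => x _; rewrite /u hahn_gfE //; by rewrite -ltnS.
rewrite (big_ord_widen K u) /K; last by lia.
rewrite big_mkcond [RHS]big_mkcond; apply: eq_bigr => x _.
rewrite ltnS; have [le_x|//] := leqP x (n + q); last by rewrite andbF.
case: leqP => //= lt_px.
by rewrite /u hahn_dual_eq0 ?mulr0 // -eq_M.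
Qed.

End DualHahn.

(** * Hermite polynomials and the inverse series *)

Section NormalizedHermite.
Variable F : numFieldType.
Implicit Types (k n : nat).

(** The coefficient of t^k in exp(2 x t - t^2). *)
Definition nhermite k : {poly F} := k`!%:R^-1 *: hermite F k.

Lemma fact_neq0 k : k`!%:R != 0 :> F.
Proof. by rewrite pnatr_eq0 -lt0n fact_gt0. Qed.

Lemma horner_nhermite k (x : F) :
  (nhermite k).[x] = (hermite F k).[x] / k`!%:R.
Proof. by rewrite /nhermite hornerZ mulrC. Qed.

(** The derivative in t of exp(2 x t - t^2), truncated. *)
Lemma deriv_hermite_gf K :
  (hermite_gf F K.+1)^`() = ((2 *: 'X)%:P - 'X *+ 2) * hermite_gf F K.
Proof.
rewrite /hermite_gf big_nat_recl //= expr0 derivD derivZ derivC scaler0 add0r.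
rewrite raddf_sum mulr_sumr; apply: eq_bigr => k _.
rewrite /= derivZ deriv_exp derivB derivM derivC mul0r add0r derivX mulr1 derivXn.
rewrite expr1 /= -!scalerMnr scalerMnl -scalerAr -rmorphMn /=.
congr (_%:P *: _); rewrite -mulr_natr factS natrM invfM.
by rewrite mulrAC mulVf ?mul1r // pnatr_eq0.
Qed.

Lemma nhermite0 : nhermite 0 = 1.
Proof.
rewrite /nhermite -(hermite_gfE F (leqnn 0)) /hermite_gf big_nat1 expr0.
by rewrite fact0 invr1 scale1r coef1.
Qed.

Lemma nhermiteS k : (k.+1)%:R *: nhermite k.+1 =
  2 *: ('X * nhermite k - (if k is j.+1 then nhermite j else 0)).
Proof.
have := congr1 (fun p : {poly {poly F}} => p`_k) (deriv_hermite_gf k.+1).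
rewrite coef_deriv hermite_gfE // -/(nhermite _) -scaler_nat => ->.
have gfE j : (j <= k.+1)%N -> (hermite_gf F k.+1)`_j = nhermite j.
  exact: hermite_gfE.
rewrite mulrBl coefB coefCM mulrnAl coefMn coefXM scalerBr.
congr (_ - _); first by rewrite -scalerAl gfE.
case: k gfE => [|k] gfE /=; first by rewrite mul0rn scaler0.
by rewrite scaler_nat gfE //; lia.
Qed.

Lemma nhermite1 : nhermite 1 = 2 *: 'X.
Proof. by have := nhermiteS 0; rewrite scale1r subr0 nhermite0 mulr1. Qed.

Lemma scalerI_nat k (u v : {poly F}) : (k.+1)%:R *: u = (k.+1)%:R *: v -> u = v.
Proof. by apply: scalerI; rewrite pnatr_eq0. Qed.

Lemma deriv_nhermite k :
  (nhermite k)^`() = if k is j.+1 then 2 *: nhermite j else 0.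
Proof.
elim/ltn_ind: k => -[|[|k]] IH; first by rewrite nhermite0 derivC.
  by rewrite nhermite1 derivZ derivX nhermite0.
apply: (@scalerI_nat k.+1); rewrite -derivZ nhermiteS derivZ derivB derivM derivX.
rewrite !IH // [RHS]scalerA [_ * 2]mulrC -[RHS]scalerA; congr (_ *: _).
rewrite mul1r -[k.+2%:R]natr1 [RHS]scalerDl nhermiteS [1 *: _]scale1r.
rewrite [RHS]addrC -addrA; congr (_ + _).
by case: k {IH} => [|k]; rewrite -scalerAr scalerBr ?scaler0.
Qed.

Section InverseSeries.
Variable w : F.
Hypothesis w2 : w ^+ 2 = -1.

(** For w = i, the coefficient of t^k in exp(- 2 x t + t^2), the inverse of the
    Hermite generating function. *)
Definition nhermite_inv k : {poly F} := w ^+ k *: (nhermite k \Po (w *: 'X)).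

Lemma nhermite_inv0 : nhermite_inv 0 = 1.
Proof. by rewrite /nhermite_inv nhermite0 expr0 scale1r comp_polyC. Qed.

Lemma nhermite_invS k : (k.+1)%:R *: nhermite_inv k.+1 =
  2 *: ((if k is j.+1 then nhermite_inv j else 0) - 'X * nhermite_inv k).
Proof.
rewrite /nhermite_inv scalerA mulrC -scalerA -comp_polyZ nhermiteS comp_polyZ.
rewrite scalerA mulrC -scalerA; congr (_ *: _).
rewrite comp_polyB comp_polyM comp_polyX scalerBr addrC -scalerAl scalerA exprSr.
rewrite -mulrA -expr2 w2 mulrN1 scaleNr -scalerAr; congr (_ - _).
case: k => [|k]; first by rewrite comp_poly0 scaler0 oppr0.
by rewrite exprSr -mulrA -expr2 w2 mulrN1 scaleNr opprK.
Qed.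

Lemma deriv_nhermite_inv k :
  (nhermite_inv k)^`() = if k is j.+1 then - 2 *: nhermite_inv j else 0.
Proof.
rewrite /nhermite_inv derivZ deriv_comp deriv_nhermite derivZ derivX.
case: k => [|k]; first by rewrite comp_poly0 mul0r scaler0.
rewrite comp_polyZ -scalerAl -scalerAr mulr1 !scalerA exprSr.
congr (_ *: _); rewrite (_ : w ^+ k * w * 2 * w = w ^+ 2 * (2 * w ^+ k)); last by ring.
by rewrite w2; ring.
Qed.

Definition hermite_conv (phi : nat -> F) K : {poly F} :=
  \sum_(j < K.+1) phi j *: (nhermite (K - j) * nhermite_inv j).

Lemma hermite_conv0 phi : hermite_conv phi 0 = (phi 0%N)%:P.
Proof.
by rewrite /hermite_conv big_ord1 nhermite0 nhermite_inv0 mulr1 -alg_polyC.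
Qed.

(** The derivatives of the two factors have opposite signs and shift the index
    of the weight phi differently, which leaves its difference. *)
Lemma deriv_hermite_conv phi K :
  (hermite_conv phi K.+1)^`() = 2 *: hermite_conv (@fdiff F phi) K.
Proof.
rewrite /hermite_conv raddf_sum /=.
under eq_bigr => j _ do rewrite derivZ derivM scalerDr.
rewrite big_split /= big_ord_recr /= subnn nhermite0 derivC mul0r scaler0 addr0.
rewrite [X in _ + X]big_ord_recl nhermite_inv0 derivC mulr0 scaler0 add0r.
rewrite -big_split scaler_sumr; apply: eq_bigr => j _ /=.
have le_jK : (j <= K)%N by rewrite -ltnS.
rewrite /bump leq0n add1n subSS subSn // !deriv_nhermite deriv_nhermite_inv.
move: (nhermite _) (nhermite_inv _) => a b.
rewrite -scalerAl -scalerAr !scalerA -scalerDl; congr (_ *: _).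
by rewrite /fdiff; ring.
Qed.

(** The two generating functions are inverse to each other. In terms of their
    recurrences: K.+1 times the sum splits as (K.+1 - j) + j, the terms in X
    cancel, and the others telescope. *)
Lemma hermite_conv1 K : hermite_conv (fun=> 1) K = (K == 0%N)%:R.
Proof.
case: K => [|K]; first by rewrite hermite_conv0.
apply: (@scalerI_nat K); rewrite scaler0 /hermite_conv.
pose h' k : {poly F} := if k is j.+1 then nhermite j else 0.
pose l' k : {poly F} := if k is j.+1 then nhermite_inv j else 0.
transitivity (\sum_(j < K.+2) (K.+1 - j)%:R *: (nhermite (K.+1 - j) * nhermite_inv j)
            + \sum_(j < K.+2) j%:R *: (nhermite (K.+1 - j) * nhermite_inv j)).
  rewrite scaler_sumr -big_split; apply: eq_bigr => j _ /=.
  by rewrite scale1r -scalerDl -natrD subnK // -ltnS.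
rewrite big_ord_recr /= subnn scale0r addr0 [X in _ + X]big_ord_recl scale0r add0r.
transitivity (2 *: (\sum_(j < K.+1) nhermite (K - j) * l' j
                  - \sum_(j < K.+1) h' (K - j)%N * nhermite_inv j)); last first.
  rewrite big_ord_recl /= mulr0 add0r big_ord_recr /= subnn mul0r addr0.
  rewrite (eq_bigr (fun i : 'I_K => h' (K - i)%N * nhermite_inv i)) ?subrr ?scaler0 //.
  move=> j _; rewrite /bump leq0n add1n /=; congr (_ * _).
  by rewrite -[in RHS](@subnSK j K).
rewrite -big_split -sumrB scaler_sumr; apply: eq_bigr => j _ /=.
have le_jK : (j <= K)%N by rewrite -ltnS.
rewrite /bump leq0n add1n subSS subSn // scalerAl nhermiteS scalerAr nhermite_invS.
rewrite -/(h' _) -/(l' _).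
move: (nhermite _) (nhermite_inv _) (h' _) (l' _) => a b a' b'.
rewrite -scalerAl -scalerAr -scalerDr; congr (_ *: _); ring.
Qed.

(** Differentiating n times replaces phi by the constant c and reduces to
    hermite_conv1; only the case K = n survives. *)
Lemma coef_hermite_conv n K phi c : (forall k, iter n (@fdiff F) phi k = c) ->
  forall m, (n <= m)%N -> (hermite_conv phi K)`_m =
    if (m == n) && (K == n) then 2 ^+ n * c / n`!%:R else 0.
Proof.
elim: n K phi => [|n IH] K phi phic m le_nm.
  have -> : hermite_conv phi K = c *: hermite_conv (fun=> 1) K.
    rewrite /hermite_conv scaler_sumr; apply: eq_bigr => j _.
    by rewrite scale1r -[phi j]/(iter 0 (@fdiff F) phi j) phic.
  rewrite hermite_conv1 coefZ; case: K => [|K]; last by rewrite coef0 mulr0 andbF.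
  by rewrite coef1; case: m {le_nm} => [|m] /=; rewrite ?mulr0 // fact0; field.
case: m le_nm => // m le_nm; case: K => [|K].
  by rewrite hermite_conv0 coefC /= andbF.
have := congr1 (fun p : {poly F} => p`_m) (deriv_hermite_conv phi K).
rewrite coef_deriv coefZ (IH K (@fdiff F phi)) // => [|k]; last by rewrite -(phic k) iterSr.
rewrite !eqSS => coefE.
have m0 : m.+1%:R != 0 :> F by rewrite pnatr_eq0.
apply: (mulIf m0); rewrite mulr_natr coefE.
case: eqP => [eq_mn|_] /=; last by rewrite mulr0 mul0r.
case: eqP => _; last by rewrite mulr0 mul0r.
rewrite eq_mn in m0 *; rewrite factS natrM exprS; field.
by rewrite ?nat1r ?natr1 m0 fact_neq0.
Qed.

End InverseSeries.

End NormalizedHermite.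

(** * Gaussian integrals of polynomials *)

Section GaussianIntegral.
Variable R : realType.
Implicit Types (p q : {poly R}) (x : R).
Notation mu := (@lebesgue_measure R).

Definition gauss_poly p x : R := p.[x] * expR (- x ^+ 2).

(** From the term of order n.+1 of the exponential series, and from 1 when
    x is at most 1 in absolute value. *)
Lemma normX_le_expR_sqr n : exists C : R, forall x, `|x ^+ n| <= C * expR (x ^+ 2 / 2).
Proof.
(* (x^2 / 2)^(n+1) / (n+1)! is at most exp(x^2 / 2) *)
exists (1 + 2 ^+ n.+1 * n.+1`!%:R) => x.
have y_ge0 : 0 <= x ^+ 2 / 2 by rewrite divr_ge0 ?sqr_ge0.
have e_ge1 : 1 <= expR (x ^+ 2 / 2).
  by apply: le_trans (expR_ge1Dx _); rewrite lerDl.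
have f_gt0 : 0 < n.+1`!%:R :> R by rewrite ltr0n fact_gt0.
have e_ge : x ^+ 2 ^+ n.+1 <= 2 ^+ n.+1 * n.+1`!%:R * expR (x ^+ 2 / 2).
  have := expR_ge1Dxn n y_ge0; rewrite expr_div_n => le1.
  have -> : x ^+ 2 ^+ n.+1 = 2 ^+ n.+1 * n.+1`!%:R *
     ((x ^+ 2) ^+ n.+1 / 2 ^+ n.+1 / n.+1`!%:R).
    by field; rewrite gt_eqF //= expf_neq0.
  rewrite ler_pM2l ?mulr_gt0 ?exprn_gt0 //.
  by apply: le_trans le1; rewrite lerDr.
rewrite mulrDl mul1r normrX.
have [x_le1|/ltW x_ge1] := leP `|x| 1.
  have xn_le1 : `|x| ^+ n <= 1 by apply: exprn_ile1.
  apply: (le_trans xn_le1).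
  apply: (le_trans e_ge1); rewrite lerDl.
  by rewrite !mulr_ge0 ?exprn_ge0 ?expR_ge0 // ltW.
apply: le_trans (_ : x ^+ 2 ^+ n.+1 <= _); last first.
  by apply: (le_trans e_ge); rewrite lerDr expR_ge0.
rewrite -(real_normK (num_real x)) -exprM; apply: ler_weXn2l => //; lia.
Qed.

(** Half of the exponent is spent on absorbing the polynomial; the other half
    keeps an integrable bound. *)
Lemma gauss_poly_bound p :
  exists C : R, forall x, `|gauss_poly p x| <= C * expR (- (x ^+ 2 / 2)).
Proof.
have expE x : expR (- x ^+ 2) = expR (- (x ^+ 2 / 2)) * expR (- (x ^+ 2 / 2)).
  by rewrite -expRD; congr expR; field.
suff [C HC] : exists C : R, forall x, `|p.[x]| <= C * expR (x ^+ 2 / 2).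
  exists C => x; rewrite /gauss_poly normrM (ger0_norm (expR_ge0 _)) expE.
  rewrite mulrA ler_pM2r ?expR_gt0 //.
  rewrite -(ler_pM2r (expR_gt0 (x ^+ 2 / 2))) -mulrA -expRD addNr expR0 mulr1.
  exact: HC.
have /choice[C HC] := normX_le_expR_sqr.
exists (\sum_(i < size p) `|p`_i| * C i) => x.
rewrite horner_coef (le_trans (ler_norm_sum _ _ _)) // mulr_suml.
apply: ler_sum => i _; rewrite normrM -mulrA ler_wpM2l //.
Qed.

(** It is a multiple of the density of the standard normal law. *)
Lemma integrable_half_gauss :
  mu.-integrable setT (EFin \o (fun x => expR (- (x ^+ 2 / 2)))).
Proof.
have := integrableZl measurableT (normal_peak 1)^-1 (@integrable_normal_pdf R 0 1).
apply: eq_integrable => // x _ /=.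
rewrite normal_pdfE ?oner_neq0 // /normal_fun -EFinM mulrA mulVf ?mul1r; last first.
  by rewrite gt_eqF // normal_peak_gt0 // oner_neq0.
by congr (expR _)%:E; rewrite subr0 expr1n; ring.
Qed.

Lemma measurable_gauss_poly p : measurable_fun setT (gauss_poly p).
Proof.
apply: measurable_funM; last exact: measurable_gauss_fun.
by apply: continuous_measurable_fun; exact: continuous_horner.
Qed.

Lemma integrable_gauss_poly p : mu.-integrable setT (EFin \o gauss_poly p).
Proof.
have [C HC] := gauss_poly_bound p.
apply: (le_integrable _ _ _ (integrableZl measurableT C integrable_half_gauss)) => //.
  by apply/measurable_EFinP; exact: measurable_gauss_poly.
move=> x _ /=; rewrite lee_fin; apply: (le_trans (HC x)); exact: ler_norm.
Qed.

Definition gauss_int p : R := \int[mu]_x gauss_poly p x.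

Lemma gauss_intD p q : gauss_int (p + q) = gauss_int p + gauss_int q.
Proof.
rewrite /gauss_int -RintegralD //; [|exact: integrable_gauss_poly..].
by apply: eq_Rintegral => x _; rewrite /gauss_poly hornerD mulrDl.
Qed.

Lemma gauss_intZ a p : gauss_int (a *: p) = a * gauss_int p.
Proof.
rewrite /gauss_int -RintegralZl //; last exact: integrable_gauss_poly.
by apply: eq_Rintegral => x _; rewrite /gauss_poly hornerZ mulrA.
Qed.

Lemma gauss_int1_gt0 : 0 < gauss_int 1.
Proof.
rewrite /gauss_int /Rintegral.
under eq_integral do rewrite /gauss_poly hornerC mul1r.
by rewrite integralT_gauss /= sqrtr_gt0 pi_gt0.
Qed.

Lemma is_derive_gauss_poly p x :
  is_derive x (1 : R) (gauss_poly p) (gauss_poly (p^`() - 2 *: ('X * p)) x).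
Proof.
have de : is_derive x (1 : R) (expR \o horner (- 'X^2 : {poly R}))
    (expR (- 'X^2).[x] * (- 'X^2)^`().[x]) by exact: is_derive1_comp.
have := is_deriveM (is_derive_poly p x) de.
rewrite [F in is_derive _ _ F _](_ : _ = gauss_poly p); last first.
  by apply/funext => y; rewrite /gauss_poly !fctE /= !hornerE.
move=> dF; apply: is_derive_eq.
have hE : (- 'X^2).[x] = - x ^+ 2 :> R by rewrite hornerN hornerXn.
have dE : (- 'X^2)^`().[x] = - (2 * x) :> R.
  by rewrite derivN derivXn hornerN hornerMn hornerX mulr_natl.
rewrite /gauss_poly /= hE dE hornerD hornerN hornerZ hornerM hornerX.
by move: (expR _) p.[x] p^`().[x] => e y z; rewrite /GRing.scale /=; ring.
Qed.

Lemma gauss_poly_cvg0 p (u : R^nat) : (forall n, n%:R <= u n ^+ 2 / 2) ->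
  gauss_poly p (u n) @[n --> \oo] --> (0 : R).
Proof.
move=> u_ge; have [C HC] := gauss_poly_bound p.
have C_ge0 : 0 <= C.
  have := le_trans (normr_ge0 _) (HC 0).
  by rewrite pmulr_lge0 // expR_gt0.
apply/norm_cvg0P.
apply: (@squeeze_cvgr _ _ _ _ (cst 0) (fun n => C * expR (- n%:R))).
- near=> n; rewrite normr_ge0 /= (le_trans (HC _)) // ler_wpM2l //.
  by rewrite ler_expR lerN2.
- exact: cvg_cst.
- rewrite -[X in _ --> X](mulr0 C); apply: cvgMr; exact: cvgn_expR.
Unshelve. all: by end_near. Qed.

Lemma integral_gauss_poly_itv p (b : R) : 0 < b ->
  (\int[mu]_(x in `[(- b)%R, b]) (gauss_poly (p^`() - 2 *: ('X * p)) x)%:E =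
   (gauss_poly p b - gauss_poly p (- b))%:E)%E.
Proof.
move=> b_gt0; have dF x := is_derive_gauss_poly p x.
have cont q : continuous (gauss_poly q).
  move=> x; apply: differentiable_continuous; apply/derivable1_diffP.
  by have [] := is_derive_gauss_poly q x.
rewrite (@continuous_FTC2 _ _ (gauss_poly p)) ?EFinB //.
- by rewrite gtrN.
- by apply: continuous_subspaceT => x; exact: cont.
- split.
  + by move=> x _; have [] := dF x.
  + by apply: cvg_at_right_filter; exact: cont.
  + by apply: cvg_at_left_filter; exact: cont.
- by move=> x _; rewrite derive1E; have [_ ->] := dF x.
Qed.

(** The integrand of the difference is the derivative of p exp(-x^2), whose
    integrals over growing intervals tend to 0; by dominated convergence they
    also tend to the integral over the line. *)
Lemma gauss_int_deriv p : gauss_int p^`() = gauss_int (2 *: ('X * p)).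
Proof.
apply/eqP; rewrite -subr_eq0; apply/eqP.
have -> : gauss_int p^`() - gauss_int (2 *: ('X * p)) =
          gauss_int (p^`() - 2 *: ('X * p)).
  by rewrite gauss_intD -[- (2 *: _)]scaleN1r [gauss_int (-1 *: _)]gauss_intZ mulN1r.
set q := _ - _.
(* the bound n.+2 makes the squared bound at least 2 n *)
pose A n : set R := `[(- n.+2%:R)%R, n.+2%:R]%classic.
pose f_ n := (EFin \o gauss_poly q) \_ (A n).
have mq : measurable_fun setT (EFin \o gauss_poly q).
  by apply/measurable_EFinP; exact: measurable_gauss_poly.
have [_ _ lim_f] : [/\ mu.-integrable setT (EFin \o gauss_poly q),
    [sequence \int[mu]_(x in setT) `|f_ n x - (EFin \o gauss_poly q) x|]_n @ \oo --> 0 &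
    [sequence \int[mu]_(x in setT) (f_ n x)]_n @ \oo
       --> \int[mu]_(x in setT) (EFin \o gauss_poly q) x]%E.
  apply: (@dominated_convergence _ _ _ mu setT measurableT f_ _
    (fun x => `|(gauss_poly q x)%:E|%E)) => //.
  - move=> n; apply: (measurable_restrictT _ _).1; last exact: measurable_funTS.
    exact: measurable_itv.
  - apply: aeW => x _; apply: cvg_near_cst.
    near=> n; rewrite /f_ patchE ifT // inE /A /= in_itv /=.
    rewrite -ler_norml; apply: (@le_trans _ _ n%:R); last by rewrite ler_nat; lia.
    near: n; exact: nbhs_infty_ger.
  - exact: integrable_abse (integrable_gauss_poly q).
  - apply: aeW => x n _; rewrite /f_ patchE; case: ifP => _ //.
    by rewrite abse0.
have sq_ge n : n%:R <= n.+2%:R ^+ 2 / 2 :> R.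
  by rewrite ler_pdivlMr // -natrX -natrM ler_nat; lia.
have lim_0 : [sequence \int[mu]_(x in setT) (f_ n x)]_n%E @ \oo --> 0%E.
  rewrite (_ : [sequence _]_n = EFin \o
     (fun n => gauss_poly p n.+2%:R - gauss_poly p (- n.+2%:R))); last first.
    apply/funext => n /=; rewrite /f_ -integral_mkcond.
    by rewrite integral_gauss_poly_itv // ltr0n.
  apply: cvg_EFin; first exact: nearW.
  rewrite -[X in _ --> X](subrr (0 : R)).
  by apply: cvgB; apply: gauss_poly_cvg0 => n; rewrite ?sqrrN.
have int0 := cvg_unique _ lim_f lim_0.
by rewrite /gauss_int /Rintegral [X in fine X]int0.
Unshelve. all: by end_near. Qed.

End GaussianIntegral.

(** * Moment functionals of Gaussian type *)

Section Moments.
Variables (F : numFieldType) (m : nat -> F).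
Implicit Types (p q : {poly F}) (a : F).

(** The linear functional on polynomials with prescribed moments. Working with
    it makes the whole theory algebraic, and valid over the complex numbers
    from real moments. *)
Definition moment_form p : F := \sum_(i < size p) p`_i * m i.

Lemma moment_formE n p : (size p <= n)%N -> moment_form p = \sum_(i < n) p`_i * m i.
Proof.
move=> le_pn; rewrite /moment_form (big_ord_widen n (fun i => p`_i * m i) le_pn).
rewrite big_mkcond; apply: eq_bigr => i _; case: ltnP => // le_pi.
by rewrite nth_default ?mul0r.
Qed.

Lemma moment_form_is_linear : scalar moment_form.
Proof.
move=> a p q; pose n := maxn (size p) (size q).
have le_pn : (size p <= n)%N by apply: leq_maxl.
have le_qn : (size q <= n)%N by apply: leq_maxr.
rewrite (moment_formE le_pn) (moment_formE le_qn) (@moment_formE n); last first.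
  apply: leq_trans (size_polyD _ _) _; rewrite geq_max le_qn andbT.
  exact: leq_trans (size_scale_leq _ _) le_pn.
rewrite mulr_sumr -big_split; apply: eq_bigr => i _ /=.
by rewrite coefD coefZ mulrDl mulrA.
Qed.

HB.instance Definition _ :=
  GRing.isLinear.Build F {poly F} F _ moment_form moment_form_is_linear.

Lemma moment_formZ a p : moment_form (a *: p) = a * moment_form p.
Proof. exact: scalarZ. Qed.

Lemma moment_form1 : moment_form 1 = m 0.
Proof. by rewrite (@moment_formE 1) ?size_poly1 // big_ord1 coef1 mul1r. Qed.

Hypothesis m1 : m 1%N = 0.
Hypothesis mSS : forall k, 2 * m k.+2 = (k.+1)%:R * m k.

Lemma moment_form_deriv p : moment_form p^`() = moment_form (2 *: ('X * p)).
Proof.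
have le_X : (size (2 *: ('X * p)) <= (size p).+2)%N.
  apply: leq_trans (size_scale_leq _ _) _; apply: leq_trans (size_polyMleq _ _) _.
  by rewrite size_polyX.
have le_d : (size p^`() <= size p)%N.
  by have [->|/lt_size_deriv/ltnW//] := eqVneq p 0; rewrite deriv0.
rewrite (moment_formE le_d) (moment_formE le_X) !big_ord_recl !coefZ !coefXM /= m1.
rewrite !mulr0 mul0r !add0r; apply: eq_bigr => i _.
rewrite coefZ coefXM coef_deriv /bump /= !add1n.
by rewrite [RHS]mulrAC mSS -mulr_natr; ring.
Qed.

(** The relation k.+1 h_(k+1) = 2 x h_k - h_k' says that multiplication by
    Hermite polynomials is adjoint to differentiation. *)
Lemma moment_form_hermiteS p k :
  (k.+1)%:R * moment_form (p * nhermite F k.+1) = moment_form (p^`() * nhermite F k).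
Proof.
rewrite -moment_formZ scalerAr nhermiteS.
have -> : 2 *: ('X * nhermite F k - (if k is j.+1 then nhermite F j else 0)) =
          2 *: ('X * nhermite F k) - (nhermite F k)^`().
  by rewrite deriv_nhermite scalerBr; case: k => [|k] //; rewrite scaler0.
rewrite mulrBr raddfB /= -scalerAr mulrCA -moment_form_deriv derivM raddfD /=.
by rewrite addrK.
Qed.

Lemma moment_form_orthogonal j k :
  moment_form (nhermite F j * nhermite F k) =
  if j == k then 2 ^+ k / k`!%:R * m 0 else 0.
Proof.
elim: k j => [|k IH] j.
  rewrite nhermite0 mulr1 fact0 divr1 expr0 mul1r.
  case: j => [|j]; first by rewrite nhermite0 moment_form1.
  have := moment_form_hermiteS 1 j; rewrite derivC !mul0r mul1r raddf0 => /eqP.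
  by rewrite mulf_eq0 pnatr_eq0 => /eqP.
have k0 : k.+1%:R != 0 :> F by rewrite pnatr_eq0.
apply: (mulfI k0); rewrite moment_form_hermiteS deriv_nhermite.
case: j => [|j]; first by rewrite mul0r raddf0 mulr0.
rewrite -scalerAl moment_formZ IH eqSS; case: eqP => _; last by rewrite !mulr0.
by rewrite factS natrM exprS; field; rewrite ?nat1r ?natr1 k0 fact_neq0.
Qed.

End Moments.

(** * Matrix polynomials and uniqueness of monic orthogonal sequences *)

Section MatrixPolynomials.
Variables (R : realType) (N : nat).
Local Notation C := R[i].
Implicit Types (A B D : 'M[{poly C}]_N) (M : 'M[C]_N).

Definition cst_mx M : 'M[{poly C}]_N := map_mx polyC M.

Lemma coef_mxE A k i j : coef_mx A k i j = (A i j)`_k.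
Proof. by rewrite mxE. Qed.

Lemma coef_mxB A B k : coef_mx (A - B) k = coef_mx A k - coef_mx B k.
Proof. by apply/matrixP => i j; rewrite !mxE coefB. Qed.

Lemma coef_cst_mxM M A k : coef_mx (cst_mx M *m A) k = M *m coef_mx A k.
Proof.
apply/matrixP => i j; rewrite !mxE coef_sum.
by apply: eq_bigr => l _; rewrite !mxE coefCM.
Qed.

(** Leading coefficients can be removed one at a time, with matrix
    coefficients on the left. *)
Lemma monic_expansion (Q : nat -> 'M[{poly C}]_N) :
  (forall n, monic_degree (Q n) n) ->
  forall n A, (forall k, (n <= k)%N -> coef_mx A k = 0) ->
  exists M : nat -> 'M[C]_N, A = \sum_(k < n) cst_mx (M k) *m Q k.
Proof.
move=> monicQ; elim=> [|n IH] A A0.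
  exists (fun=> 0); rewrite big_ord0; apply/matrixP => i j; rewrite mxE.
  by apply/polyP => k; rewrite coef0 -coef_mxE A0 // mxE.
have [k le_nk|M eqA] := IH (A - cst_mx (coef_mx A n) *m Q n).
  rewrite coef_mxB coef_cst_mxM; have [lead_Q high_Q] := monicQ n.
  case: (ltngtP n k) le_nk => // [lt_nk|<-] _; last by rewrite lead_Q mulmx1 subrr.
  by rewrite high_Q // mulmx0 subr0 A0.
exists (fun k => if k == n then coef_mx A n else M k).
rewrite big_ord_recr /= eqxx -[LHS](subrK (cst_mx (coef_mx A n) *m Q n)) eqA.
by congr (_ + _); apply: eq_bigr => k _; rewrite ltn_eqF.
Qed.

Local Notation pconj := (map_poly (@Num.conj C)).

Variables (m : nat -> C) (L : 'M[{poly C}]_N) (W : 'M[C]_N).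

(** The matrix-valued sesquilinear form with weight L W L^* with respect to
    the functional with moments m. *)
Definition weight_form A B : 'M[C]_N :=
  map_mx (moment_form m) (A *m L *m cst_mx W *m (map_mx pconj (B *m L))^T).

Lemma moment_form_cst_mull M A :
  map_mx (moment_form m) (cst_mx M *m A) = M *m map_mx (moment_form m) A.
Proof.
apply/matrixP => i j; rewrite !mxE raddf_sum.
by apply: eq_bigr => l _; rewrite /= !mxE mul_polyC moment_formZ.
Qed.

Lemma moment_form_cst_mulr M A :
  map_mx (moment_form m) (A *m cst_mx M) = map_mx (moment_form m) A *m M.
Proof.
apply/matrixP => i j; rewrite !mxE raddf_sum.
by apply: eq_bigr => l _; rewrite /= !mxE mulrC mul_polyC moment_formZ mulrC.
Qed.

Lemma weight_formZl M A B : weight_form (cst_mx M *m A) B = M *m weight_form A B.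
Proof. by rewrite /weight_form -!mulmxA moment_form_cst_mull. Qed.

Lemma weight_formZr M A B :
  weight_form A (cst_mx M *m B) = weight_form A B *m (map_mx Num.conj M)^T.
Proof.
rewrite /weight_form -moment_form_cst_mulr -[cst_mx M *m B *m L]mulmxA map_mxM trmx_mul.
rewrite mulmxA; congr (map_mx _ (_ *m _)); apply/matrixP => i j.
by rewrite !mxE /= map_polyC.
Qed.

Lemma weight_form_suml n (A : nat -> 'M[{poly C}]_N) B :
  weight_form (\sum_(k < n) A k) B = \sum_(k < n) weight_form (A k) B.
Proof.
by rewrite /weight_form !mulmx_suml raddf_sum.
Qed.

Lemma weight_form_sumr n A (B : nat -> 'M[{poly C}]_N) :
  weight_form A (\sum_(k < n) B k) = \sum_(k < n) weight_form A (B k).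
Proof.
rewrite /weight_form !mulmx_suml; elim/big_rec2: _ => [|k S T _ <-].
  by rewrite map_mx0 trmx0 mulmx0 raddf0.
by rewrite map_mxD linearD /= mulmxDr map_mxD.
Qed.

Lemma weight_formB A B D : weight_form (A - B) D = weight_form A D - weight_form B D.
Proof. by rewrite /weight_form !mulmxBl raddfB. Qed.

(** Expand P n - Q n, of degree less than n, along the Q k: the form of
    P n - Q n against Q k is zero on the one hand, since both P n and Q n are
    orthogonal to lower degrees, and is the coefficient times the invertible
    norm of Q k on the other hand. *)
Lemma monic_orthogonal_unique (P Q : nat -> 'M[{poly C}]_N) :
  (forall n, monic_degree (P n) n) -> (forall n, monic_degree (Q n) n) ->
  (forall n k, n <> k -> weight_form (P n) (P k) = 0) ->
  (forall n k, n <> k -> weight_form (Q n) (Q k) = 0) ->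
  (forall n, weight_form (Q n) (Q n) \in unitmx) ->
  forall n, P n = Q n.
Proof.
move=> monicP monicQ orthP orthQ unitQ n; apply/eqP; rewrite -subr_eq0; apply/eqP.
have PQ0 k : (k < n)%N -> weight_form (P n) (Q k) = 0.
  move=> lt_kn; have [|M ->] := monic_expansion monicP (n := k.+1) (A := Q k).
    by move=> l; apply: (monicQ k).2.
  rewrite (weight_form_sumr k.+1 (P n) (fun j => cst_mx (M j) *m P j)) big1 // => j _.
  rewrite weight_formZr orthP ?mul0mx //; have := ltn_ord j; lia.
have [k le_nk|M eqD] := monic_expansion monicQ (n := n) (A := P n - Q n).
  rewrite coef_mxB; case: (ltngtP n k) le_nk => // [lt_nk|<-] _.
    by rewrite (monicP n).2 // (monicQ n).2 // subrr.
  by rewrite (monicP n).1 (monicQ n).1 subrr.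
rewrite eqD big1 // => k _.
suff -> : M k = 0 by rewrite /cst_mx map_mx0 mul0mx.
have := weight_formB (P n) (Q n) (Q k).
rewrite (PQ0 k) // (orthQ n k) ?subr0; last by have := ltn_ord k; lia.
rewrite eqD (weight_form_suml n (fun j => cst_mx (M j) *m Q j)) (bigD1 k) //=.
rewrite big1 ?addr0 => [|j neq_jk]; last first.
  by rewrite weight_formZl orthQ ?mulmx0 // => /val_inj eq_jk; rewrite eq_jk eqxx in neq_jk.
rewrite weight_formZl => /(congr1 (mulmxr (invmx (weight_form (Q k) (Q k))))) /=.
by rewrite mulmxK // mul0mx.
Qed.

End MatrixPolynomials.

(** * The explicit monic sequence *)

Section Toeplitz.
Variables (F : numFieldType) (w : F).

(** Multiplying a row with entries phi(s) h_(M - s) by a column of the inverse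
    Toeplitz matrix gives a convolution. The sum stops at s = p instead of
    s = M, which is why phi has to vanish in between. *)
Lemma toeplitz_sum p M t (phi : nat -> F) :
  (forall s, (p < s <= M)%N -> phi s = 0) ->
  \sum_(s < p.+1) (if (s <= M)%N then phi s *: nhermite F (M - s) else 0)
                  * (if (t <= s)%N then nhermite_inv w (s - t) else 0)
  = if (t <= M)%N then hermite_conv w (fun j => phi (t + j)%N) (M - t) else 0.
Proof.
move=> phi0.
pose u (s : nat) : {poly F} := if (t <= s <= M)%N then
  phi s *: (nhermite F (M - s) * nhermite_inv w (s - t)) else 0.
pose K := (p + M).+1.
have u_eq0 s : (p < s)%N -> u s = 0.
  move=> lt_ps; rewrite /u; case: andP => // -[_ le_sM].
  by rewrite phi0 ?scale0r // lt_ps.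
transitivity (\sum_(s < M.+1) u s).
  transitivity (\sum_(s < p.+1) u s).
    apply: eq_bigr => s _; rewrite /u.
    by case: leqP => _; case: leqP => _; rewrite /= ?mulr0 ?mul0r // scalerAl.
  rewrite (big_ord_widen K u) ?(big_ord_widen (n1 := M.+1) K u) /K; try lia.
  rewrite big_mkcond [RHS]big_mkcond; apply: eq_bigr => s _.
  rewrite !ltnS; case: (leqP s p) => [_|lt_ps]; last by rewrite u_eq0 // if_same.
  by case: (leqP s M) => // lt_Ms; rewrite /u ifF //; lia.
case: leqP => [le_tM|lt_Mt]; last first.
  by rewrite big1 // => s _; rewrite /u ifF //; have := ltn_ord s; lia.
rewrite (sum_shift (t := u) le_tM) => [|s lt_st]; last by rewrite /u ifF //; lia.
apply: eq_bigr => j _; have := ltn_ord j => lt_j.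
by rewrite /u ifT ?addKn ?subnDA //; lia.
Qed.

End Toeplitz.

Section Candidate.
Variables (R : realType) (p : nat).
Local Notation N := p.+1.
Local Notation C := R[i].
Local Notation pconj := (map_poly (@Num.conj C)).

Lemma pconj_nhermite k : pconj (nhermite C k) = nhermite C k.
Proof.
elim/ltn_ind: k => -[|k] IH; first by rewrite nhermite0 rmorph1.
apply: (@scalerI_nat C k); rewrite -[in LHS](rmorph_nat (@Num.conj C)) -map_polyZ.
rewrite nhermiteS map_polyZ rmorph_nat rmorphB rmorphM /= map_polyX IH //.
by case: k IH => [|k] IH; rewrite ?rmorph0 ?IH.
Qed.

Definition Lpoly : 'M[{poly C}]_N :=
  \matrix_(i, j) if (j <= i)%N then nhermite C (i - j) else 0.

Definition Lpoly_inv : 'M[{poly C}]_N :=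
  \matrix_(i, j) if (j <= i)%N then nhermite_inv 'i%C (i - j) else 0.

(** The product in the other order is the case phi = 1 of toeplitz_sum. *)
Lemma Lpoly_invK : Lpoly_inv *m Lpoly = 1%:M.
Proof.
apply: mulmx1C; apply/matrixP => i j; rewrite !mxE.
under eq_bigr => s _ do rewrite !mxE -[nhermite _ _]scale1r.
rewrite (@toeplitz_sum _ _ _ _ _ (fun=> 1)) => [|s]; last first.
  by have := ltn_ord i; lia.
rewrite hermite_conv1 ?sqr_i //; case: leqP => [le_ji|lt_ij].
  by rewrite subn_eq0 -(inj_eq val_inj) /= eqn_leq le_ji andbT.
by rewrite -(inj_eq val_inj) ltn_eqF.
Qed.

Variable kappa : R.
Hypothesis kappa_gt0 : 0 < kappa.

(** The normalization that makes the n-th difference of row_coef equal to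
    n! / 2^n, as needed for a monic polynomial. *)
Definition row_scale n q : R :=
  pochhammer (1 + kappa) n
  / (2 ^+ n * q`!%:R * pochhammer (1 + kappa + (p - q)%:R) n).

Definition row_coef n q s : R := row_scale n q * (n + q)`!%:R * hahn_dual p kappa n q s.

Definition hermite_rows n : 'M[{poly C}]_N :=
  \matrix_(q, s) if (s <= n + q)%N
    then (row_coef n q s)%:C%C *: nhermite C (n + q - s) else 0.

(** The link with the formula to be proved: the entry of hermite_rows is
    row_scale n q times p^_s hahn(s) H_(n + q - s). *)
Lemma row_coefE n q s : (q <= p)%N -> (s <= p)%N -> (s <= n + q)%N ->
  row_coef n q s / (n + q - s)`!%:R =
  row_scale n q * ((p ^_ s)%:R * hahn p kappa n q s).
Proof.
move=> le_qp le_sp le_s.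
rewrite hahn_duality // /row_coef -(ffact_fact le_s) natrM; field.
exact: fact_neq0.
Qed.

Lemma iter_fdiff_row_coef n q k : (q <= p)%N ->
  iter n (@fdiff R) (row_coef n q) k = n`!%:R / 2 ^+ n.
Proof.
move=> le_qp.
have iterZ a (f : nat -> R) l j :
    iter l (@fdiff R) (fun x => a * f x) j = a * iter l (@fdiff R) f j.
  by elim: l j => [|l IH] j //=; rewrite /fdiff !IH mulrBr.
have k1 : 0 < 1 + kappa by rewrite addr_gt0.
have k2 : 0 < 1 + kappa + (p - q)%:R by rewrite ltr_wpDr.
rewrite iterZ fdiff_hahn_dual // /row_scale; field.
by rewrite !fact_neq0 expf_neq0 ?pnatr_eq0 //= !gt_eqF // poch_gt0.
Qed.

Lemma iter_fdiff_toC n (f : nat -> R) k :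
  iter n (@fdiff C) (fun x => (f x)%:C%C) k = (iter n (@fdiff R) f k)%:C%C.
Proof.
by elim: n k => [|n IH] k //=; rewrite /fdiff !IH rmorphB.
Qed.

Lemma hermite_rowsM n (q t : 'I_N) :
  (hermite_rows n *m Lpoly_inv) q t =
  if (t <= n + q)%N
  then hermite_conv 'i%C (fun j => (row_coef n q (t + j))%:C%C) (n + q - t) else 0.
Proof.
rewrite mxE; under eq_bigr => s _ do rewrite !mxE.
rewrite (@toeplitz_sum _ _ _ _ _ (fun s => (row_coef n q s)%:C%C)) // => s ps.
by rewrite /row_coef hahn_dual_eq0 ?mulr0 //; have := ltn_ord q; lia.
Qed.

(** Every entry of the product is a convolution with a weight of degree n, hence
    has degree at most n, and its coefficient of degree n is 1 if
    n + q - t = n and 0 otherwise. *)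
Lemma monic_hermite_rows n : monic_degree (hermite_rows n *m Lpoly_inv) n.
Proof.
have coefE (q t : 'I_N) k : (n <= k)%N ->
    ((hermite_rows n *m Lpoly_inv) q t)`_k = ((k == n) && (q == t))%:R.
  move=> le_nk; rewrite hermite_rowsM; case: leqP => [le_t|lt_t]; last first.
    by rewrite coef0 -[q == t](inj_eq val_inj) [val q == _]ltn_eqF ?andbF //=; lia.
  rewrite (@coef_hermite_conv _ _ (sqr_i R) n _ _ (n`!%:R / 2 ^+ n)) // => [|j].
    have -> : (n + q - t == n)%N = (q == t).
      by rewrite -[q == t](inj_eq val_inj) /=; lia.
    case: ifP => //= _; rewrite -[RHS]/1; field.
    by rewrite fact_neq0 expf_neq0 // pnatr_eq0.
  rewrite (iter_fdiff_toC n (fun j => row_coef n q (t + j))).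
  have shiftE l (f : nat -> R) i :
      iter l (@fdiff R) (fun x => f (t + x)%N) i = iter l (@fdiff R) f (t + i)%N.
    by elim: l i => [|l IH] i //=; rewrite /fdiff !IH addnS.
  rewrite shiftE iter_fdiff_row_coef; last by rewrite -ltnS.
  by rewrite rmorphM fmorphV rmorphXn !rmorph_nat.
split=> [|k lt_nk]; apply/matrixP => q t; rewrite coef_mxE coefE ?(ltnW lt_nk) //.
  by rewrite eqxx mxE.
by rewrite gtn_eqF // mxE.
Qed.

End Candidate.

(** * Orthogonality of the explicit sequence *)

Section CandidateForm.
Variables (R : realType) (p : nat) (kappa : R) (alpha delta mu : nat -> R).
Local Notation N := p.+1.
Local Notation C := R[i].
Local Notation pconj := (map_poly (@Num.conj C)).
Hypothesis kappa_gt0 : 0 < kappa.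
Hypothesis alpha_neq0 : forall k, (1 <= k <= N)%N -> alpha k != 0.
Hypothesis delta_gt0 : forall k, (1 <= k <= N)%N -> 0 < delta k.
Hypothesis ratio : forall k, (1 <= k < N)%N ->
  delta k.+1 / alpha k.+1 ^+ 2 =
  delta k / alpha k ^+ 2 * (2 * (k%:R + kappa) / (k%:R * (N%:R - k%:R))).
Hypothesis mu0_gt0 : 0 < mu 0.
Hypothesis mu1 : mu 1%N = 0.
Hypothesis muSS : forall k, 2 * mu k.+2 = (k.+1)%:R * mu k.

Let weight_ratio s : R := delta s.+1 / alpha s.+1 ^+ 2.

(** The factors of the recurrence multiply up to 2^s (1 + kappa)_s over
    s! p^_s. *)
Lemma weight_ratioE s : (s <= p)%N ->
  weight_ratio s * ((p ^_ s)%:R * s`!%:R) =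
  weight_ratio 0 * (2 ^+ s * pochhammer (1 + kappa) s).
Proof.
elim: s => [|s IH] lt_sp; first by rewrite ffactn0 fact0 poch0 expr0.
rewrite {1}/weight_ratio ratio //.
rewrite -/(weight_ratio s) ffactnSr factS pochSr !natrM exprS natrB; last by lia.
have -> : N%:R - (s.+1)%:R = p%:R - s%:R :> R by rewrite -!natr1; ring.
have ps0 : p%:R - s%:R != 0 :> R.
  by rewrite -natrB ?pnatr_eq0 -?lt0n ?subn_gt0 // ltnW.
have s0 : (s.+1)%:R != 0 :> R by rewrite pnatr_eq0.
transitivity (weight_ratio s * ((p ^_ s)%:R * s`!%:R) * (2 * (s.+1%:R + kappa))).
  by field; rewrite ?nat1r ?natr1 s0 ps0.
rewrite IH; last exact: ltnW.
rewrite -[s.+1%:R]nat1r; move: (weight_ratio 0) (pochhammer _ s) => a b; ring.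
Qed.

Definition diag_conj (X : 'M[{poly C}]_N) : 'M[{poly C}]_N :=
  cst_mx (diagC N alpha) *m X *m cst_mx (diagC N (fun k => (alpha k)^-1)).

Lemma diag_conjE X i j :
  diag_conj X i j = (alpha i.+1 / alpha j.+1)%:C%C *: X i j.
Proof.
rewrite /diag_conj /cst_mx /diagC !map_diag_mx mul_mx_diag mul_diag_mx !mxE.
by rewrite mulrAC -polyCM -rmorphM mul_polyC.
Qed.

Lemma alphaV (i : 'I_N) : alpha i.+1 / alpha i.+1 = 1.
Proof. by rewrite divff // alpha_neq0 //= ltn_ord. Qed.

Lemma diag_conjM X Y : diag_conj X *m diag_conj Y = diag_conj (X *m Y).
Proof.
apply/matrixP => i j; rewrite diag_conjE !mxE scaler_sumr.
apply: eq_bigr => s _; rewrite !diag_conjE -scalerAl -scalerAr scalerA -rmorphM.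
by rewrite -mulrA [_^-1 * _]mulrA [_^-1 * _]mulrC alphaV mul1r.
Qed.

Lemma monic_diag_conj X n : monic_degree X n -> monic_degree (diag_conj X) n.
Proof.
move=> [lead_X high_X]; split=> [|k lt_nk]; apply/matrixP => i j.
  rewrite coef_mxE diag_conjE coefZ -coef_mxE lead_X !mxE.
  by case: eqP => [->|_]; rewrite ?mulr0 // alphaV mulr1.
by rewrite coef_mxE diag_conjE coefZ -coef_mxE high_X // mxE mulr0.
Qed.

Definition explicit_poly n : 'M[{poly C}]_N :=
  diag_conj (hermite_rows p kappa n *m Lpoly_inv R p).

Lemma monic_explicit_poly n : monic_degree (explicit_poly n) n.
Proof. exact/monic_diag_conj/monic_hermite_rows. Qed.

Local Notation form := (weight_form (fun k => (mu k)%:C%C) (diag_conj (Lpoly R p))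
                              (diagC N delta)).

(** The factors L^-1 L and S^-1 S cancel, and what remains is a sum over s of
    products of two Hermite polynomials of degrees n + i - s and k + j - s. *)
Lemma form_explicit_poly n k i j : form (explicit_poly n) (explicit_poly k) i j =
  (alpha i.+1 * alpha j.+1 * \sum_(s < N | (s <= n + i)%N && (n + i == k + j)%N)
     weight_ratio s * row_coef p kappa n i s * row_coef p kappa k j s
     * (2 ^+ (n + i - s) / (n + i - s)`!%:R * mu 0))%:C%C.
Proof.
rewrite /weight_form /explicit_poly !diag_conjM -!(mulmxA _ (Lpoly_inv R p)).
rewrite Lpoly_invK !mulmx1 mxE.
rewrite mxE raddf_sum mulr_sumr (rmorph_sum (real_complex R)) [RHS]big_mkcond.
apply: eq_bigr => s _.
have E1 X : (diag_conj X *m cst_mx (diagC N delta)) i s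
            = (delta s.+1)%:C%C *: diag_conj X i s.
  rewrite /cst_mx /diagC map_diag_mx mul_mx_diag [LHS]mxE mulrC.
  by rewrite [map_mx _ _ _ _]mxE [(\row__ _) _ _]mxE mul_polyC.
have E2 X : (map_mx pconj (diag_conj X))^T s j = pconj (diag_conj X j s).
  by rewrite [LHS]mxE [LHS]mxE.
rewrite /= E1 E2 !diag_conjE map_polyZ /= [hermite_rows _ _ _ _ _]mxE.
rewrite [hermite_rows _ _ k _ _]mxE.
have conj_real (x : R) : Num.conj x%:C%C = x%:C%C.
  by apply/CrealP; apply/complex_realP; exists x.
rewrite conj_real (fun_if (map_poly _)) map_polyZ /= conj_real pconj_nhermite raddf0.
case: (leqP s (n + i)) => [le_sn|_]; last by rewrite scaler0 scaler0 mul0r raddf0.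
case: (leqP s (k + j)) => [le_sk|lt_ks]; last first.
  by rewrite ifF ?scaler0 ?mulr0 ?raddf0 //=; lia.
have muC1 : (mu 1%N)%:C%C = 0 :> C by rewrite mu1.
have muCSS l : 2 * (mu l.+2)%:C%C = l.+1%:R * (mu l)%:C%C :> C.
  by rewrite -(rmorph_nat (real_complex R) 2)
     -(rmorph_nat (real_complex R) l.+1) -!rmorphM muSS.
have := @moment_form_orthogonal C (fun l => (mu l)%:C%C) muC1 muCSS (n + i - s) (k + j - s).
move: (nhermite _ (n + i - s)) (nhermite _ (k + j - s)) => a b form_ab.
have -> (c1 c2 c3 c4 c5 : C) :
    moment_form (fun l => (mu l)%:C%C) (c1 *: (c2 *: (c3 *: a)) * (c4 *: (c5 *: b)))
    = c1 * (c2 * (c3 * (c4 * (c5 * moment_form (fun l => (mu l)%:C%C) (a * b))))).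
  by rewrite -!scalerAl -!scalerAr !moment_formZ.
rewrite form_ab.
have -> : (n + i - s == k + j - s)%N = (n + i == k + j)%N by lia.
case: eqP => [eq_M|_] /=; last by rewrite !mulr0.
rewrite -eq_M -!(rmorph_nat (real_complex R)) -rmorphXn -fmorphV -!rmorphM /=.
congr (_%:C%C); rewrite /weight_ratio; field.
by rewrite fact_neq0 !alpha_neq0 //= ltn_ord.
Qed.

(** In form_explicit_poly, use row_coefE for the row of larger degree and keep
    the polynomial row_coef for the other one: by weight_ratioE the sum is a
    multiple of the one in hahn_orthogonal. *)
Lemma form_explicit_poly_orthogonal n k : n <> k ->
  form (explicit_poly n) (explicit_poly k) = 0.
Proof.
move=> neq_nk; apply/matrixP => i j; rewrite form_explicit_poly [RHS]mxE.
have [eq_M|neq_M] := eqVneq (n + i)%N (k + j)%N; last first.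
  by rewrite big1 ?mulr0 // => s; rewrite andbF.
have le_ip : (i <= p)%N by rewrite -ltnS.
have le_jp : (j <= p)%N by rewrite -ltnS.
have termE l q s : (q <= p)%N -> (s <= p)%N -> (s <= l + q)%N -> forall y,
    weight_ratio s * row_coef p kappa l q s * y
    * (2 ^+ (l + q - s) / (l + q - s)`!%:R * mu 0) =
    weight_ratio 0 * row_scale p kappa l q * 2 ^+ (l + q) * mu 0
    * (pochhammer (1 + kappa) s / s`!%:R * hahn p kappa l q s * y).
  move=> le_qp le_sp le_s y.
  have phiE := row_coefE kappa_gt0 le_qp le_sp le_s.
  transitivity (weight_ratio s * (row_coef p kappa l q s / (l + q - s)`!%:R)
                * (2 ^+ (l + q - s) * mu 0 * y)); first by field; exact: fact_neq0.
  have ratio_s : weight_ratio s * (p ^_ s)%:R =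
      weight_ratio 0 * (2 ^+ s * pochhammer (1 + kappa) s) / s`!%:R.
    by rewrite -weight_ratioE //; move: (weight_ratio s) => z; field; exact: fact_neq0.
  rewrite phiE -[in X in _ = _ * X * _ * _](subnK le_s) exprD.
  transitivity (weight_ratio s * (p ^_ s)%:R * (row_scale p kappa l q * hahn p kappa l q s)
                * (2 ^+ (l + q - s) * mu 0 * y)); first by ring.
  by rewrite ratio_s; field; exact: fact_neq0.
(* by symmetry the first index carries the larger degree *)
suff sum0 l q l' q' : (q <= p)%N -> (q' <= p)%N -> (l' < l)%N ->
    (l + q = l' + q')%N ->
    \sum_(s < N | (s <= l + q)%N) weight_ratio s * row_coef p kappa l q s
      * row_coef p kappa l' q' s
      * (2 ^+ (l + q - s) / (l + q - s)`!%:R * mu 0) = 0.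
  under eq_bigl => s do rewrite andbT.
  have [lt_nk|le_kn] := ltnP n k.
    have := sum0 k j n i le_jp le_ip lt_nk (esym eq_M); rewrite -eq_M.
    under eq_bigr => s _ do rewrite (mulrAC (weight_ratio s)).
    by move=> ->; rewrite mulr0.
  by rewrite sum0 ?mulr0 //; lia.
move=> le_qp le_qp' lt_l eq_l.
rewrite (eq_bigr (fun s : 'I_N => weight_ratio 0 * row_scale p kappa l q * 2 ^+ (l + q)
    * mu 0 * row_scale p kappa l' q' * (l' + q')`!%:R
    * (pochhammer (1 + kappa) s / s`!%:R * hahn p kappa l q s
       * hahn_dual p kappa l' q' s))) => [|s le_s].
  by rewrite -mulr_sumr hahn_orthogonal ?mulr0.
have le_sp : (s <= p)%N by rewrite -ltnS.
rewrite termE // /row_coef.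
move: (weight_ratio 0) (row_scale _ _ l q) (row_scale _ _ l' q') ((l' + q')`!%:R) (mu _)
  => x1 x2 x3 x4 x5.
move: (_ / _) (hahn _ _ _ _ _) (hahn_dual _ _ _ _ _) (2 ^+ _) => x6 x7 x8 x9.
ring.
Qed.

(** The norm is diagonal, and its diagonal entries are sums of nonnegative terms
    whose term s = 0 is positive. *)
Lemma form_explicit_poly_unit n : form (explicit_poly n) (explicit_poly n) \in unitmx.
Proof.
have -> : form (explicit_poly n) (explicit_poly n) =
          diag_mx (\row_i form (explicit_poly n) (explicit_poly n) i i).
  apply/matrixP => i j; rewrite [RHS]mxE [X in _ = X *+ _]mxE.
  case: eqVneq => [->|neq_ij]; first by rewrite mulr1n.
  rewrite mulr0n form_explicit_poly big1 ?mulr0 // => s.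
  by rewrite eqn_add2l (inj_eq val_inj) (negPf neq_ij) andbF.
rewrite unitmxE det_diag unitfE prodf_seq_neq0; apply/allP => i _ /=.
rewrite [(\row__ _) _ _]mxE form_explicit_poly.
rewrite -(rmorph0 (real_complex R)) (inj_eq (@complexI R)).
have a0 (q : 'I_N) : alpha q.+1 != 0 by rewrite alpha_neq0 //= ltn_ord.
rewrite !mulf_neq0 ?a0 // gt_eqF // (bigD1 ord0) ?leq0n ?eqxx //=.
have r_gt0 s : (s <= p)%N -> 0 < weight_ratio s.
  move=> le_sp; rewrite divr_gt0 ?delta_gt0 //.
  by rewrite exprn_even_gt0 //= alpha_neq0.
have c_gt0 l : 0 < 2 ^+ (n + i - l) / (n + i - l)`!%:R * mu 0.
  by rewrite mulr_gt0 ?divr_gt0 ?exprn_gt0 ?ltr0n ?fact_gt0.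
apply: ltr_wpDr; last first.
  rewrite mulr_gt0 // -mulrA -expr2 mulr_gt0 ?r_gt0 // exprn_even_gt0 //=.
  rewrite /row_coef /row_scale /hahn_dual big_ord_recl big1 => [|j _]; last first.
    by rewrite bin0n /= mulr0.
  rewrite bin0 /hahn_dual_coef !poch0 expr0 !mulr1 divr1 addr0 mulr1.
  have k1 : 0 < 1 + kappa by rewrite addr_gt0.
  have k2 : 0 < 1 + kappa + (p - i)%:R by rewrite ltr_wpDr.
  rewrite !mulf_neq0 ?invr_eq0 ?mulf_neq0 ?fact_neq0 ?expf_neq0 ?pnatr_eq0 //.
    by rewrite gt_eqF // poch_gt0.
  by rewrite gt_eqF // poch_gt0.
apply: sumr_ge0 => s _; rewrite mulr_ge0 ?(ltW (c_gt0 _)) // -mulrA -expr2.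
by rewrite mulr_ge0 ?sqr_ge0 // ltW // r_gt0 // -ltnS.
Qed.

End CandidateForm.

(** * The integral against the weight as an algebraic form *)

Section GaussMoments.
Variable R : realType.
Local Notation C := R[i].
Local Notation mu := (@lebesgue_measure R).

Definition gauss_moment k : R := gauss_int ('X^k : {poly R}).

Lemma gauss_moment0_gt0 : 0 < gauss_moment 0.
Proof. by rewrite /gauss_moment expr0 gauss_int1_gt0. Qed.

Lemma gauss_moment1 : gauss_moment 1 = 0.
Proof.
have := gauss_int_deriv (1 : {poly R}); rewrite derivC mulr1 gauss_intZ.
have -> : gauss_int (0 : {poly R}) = 0.
  by rewrite -(scale0r (0 : {poly R})) gauss_intZ mul0r.
move/esym/eqP; rewrite mulf_eq0 pnatr_eq0 /= => /eqP.
by rewrite /gauss_moment expr1.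
Qed.

Lemma gauss_momentSS k :
  2 * gauss_moment k.+2 = k.+1%:R * gauss_moment k.
Proof.
have dX : ('X^(k.+1) : {poly R})^`() = (k.+1)%:R *: 'X^k.
  by rewrite derivXn scaler_nat.
by rewrite /gauss_moment -!gauss_intZ -dX gauss_int_deriv -exprS.
Qed.

Lemma gauss_int_poly n (E : nat -> R) :
  gauss_int (\poly_(i < n) E i) = \sum_(i < n) E i * gauss_moment i.
Proof.
have g0 : gauss_int (0 : {poly R}) = 0.
  by rewrite -(scale0r (0 : {poly R})) gauss_intZ mul0r.
rewrite poly_def (big_morph _ (@gauss_intD R) g0).
by apply: eq_bigr => i _; rewrite gauss_intZ.
Qed.

Local Notation cmoment := (fun k => (gauss_moment k)%:C%C).

Lemma ReD (z t : C) : complex.Re (z + t) = complex.Re z + complex.Re t.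
Proof. by case: z t => [a b] [e f]. Qed.

Lemma ImD (z t : C) : complex.Im (z + t) = complex.Im z + complex.Im t.
Proof. by case: z t => [a b] [e f]. Qed.

Lemma Re_mulr (z : C) (a : R) : complex.Re (z * a%:C%C) = complex.Re z * a.
Proof. by case: z => [b e] /=; rewrite mulr0 subr0. Qed.

Lemma Im_mulr (z : C) (a : R) : complex.Im (z * a%:C%C) = complex.Im z * a.
Proof. by case: z => [b e] /=; rewrite mulr0 add0r. Qed.

(** Real and imaginary parts are treated alike: both are additive and commute
    with multiplication by reals. *)
Lemma integral_gauss_moment_form (q : {poly C}) :
  ((\int[mu]_x complex.Re ((expR (- x ^+ 2))%:C%C * q.[x%:C%C])) +i*
   (\int[mu]_x complex.Im ((expR (- x ^+ 2))%:C%C * q.[x%:C%C])))%C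
  = moment_form cmoment q.
Proof.
have coordE (f : C -> R) : (forall z t, f (z + t) = f z + f t) ->
    (forall z a, f (z * a%:C%C) = f z * a) ->
    \int[mu]_x f ((expR (- x ^+ 2))%:C%C * q.[x%:C%C]) = f (moment_form cmoment q).
  move=> fD fM; have f0 : f 0 = 0 by rewrite -(mulr0 (0 : C)) fM mulr0.
  transitivity (gauss_int (\poly_(i < size q) f q`_i)).
    apply: eq_Rintegral => x _.
    rewrite /gauss_poly horner_poly mulrC fM horner_coef (big_morph f fD f0).
    by congr (_ * _); apply: eq_bigr => i _; rewrite -rmorphXn fM.
  rewrite gauss_int_poly /moment_form (big_morph f fD f0).
  by apply: eq_bigr => i _; rewrite fM.
rewrite (coordE (@complex.Re R)); [|exact: ReD|exact: Re_mulr].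
rewrite (coordE (@complex.Im R)); [|exact: ImD|exact: Im_mulr].
by case: (moment_form _ _).
Qed.

Variables (p : nat) (alpha delta : nat -> R).
Local Notation N := p.+1.
Hypothesis alpha_neq0 : forall k, (1 <= k <= N)%N -> alpha k != 0.

Lemma eval_mxM (A B : 'M[{poly C}]_N) z :
  eval_mx (A *m B) z = eval_mx A z *m eval_mx B z.
Proof.
apply/matrixP => i j; rewrite !mxE horner_sum.
by apply: eq_bigr => s _; rewrite hornerM !mxE.
Qed.

Lemma eval_cst_mx (M : 'M[C]_N) z : eval_mx (cst_mx M) z = M.
Proof. by apply/matrixP => i j; rewrite !mxE hornerC. Qed.

Lemma eval_conj_mx (A : 'M[{poly C}]_N) (x : R) :
  eval_mx ((map_mx (map_poly (@Num.conj C)) A)^T) x%:C%C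
  = ((eval_mx A x%:C%C) ^t*%sesqui).
Proof.
apply/matrixP => i j; rewrite !mxE /=.
have conj_x : Num.conj x%:C%C = x%:C%C :> C.
  by apply/CrealP; apply/complex_realP; exists x.
by rewrite -[in LHS]conj_x horner_map.
Qed.

Lemma invmx_diagC : invmx (diagC N alpha) = diagC N (fun k => (alpha k)^-1).
Proof.
have mulV : diagC N (fun k => (alpha k)^-1) *m diagC N alpha = 1%:M.
  rewrite /diagC mulmx_diag -diag_const_mx; congr diag_mx.
  apply/rowP => j; rewrite !mxE -rmorphM mulVf ?rmorph1 //.
  by rewrite alpha_neq0 //= ltn_ord.
have [_ u] := mulmx1_unit mulV.
by rewrite -[LHS]mul1mx -mulV mulmxK.
Qed.

Lemma eval_Lalpha (x : R) :
  eval_mx (diag_conj alpha (Lpoly R p)) x%:C%C = Lalpha N alpha x.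
Proof.
rewrite /Lalpha invmx_diagC /diag_conj !eval_mxM !eval_cst_mx.
congr (_ *m _ *m _); apply/matrixP => i j; rewrite !mxE.
by case: ifP => _; rewrite ?horner0 // /nhermite hornerZ mulrC.
Qed.

(** For real x, conjugation of the values is evaluation of the conjugate
    polynomial, so the integrand is exp(-x^2) times the value of a matrix
    polynomial. *)
Lemma integral_weight (A B : 'M[{poly C}]_N) :
  integral_mx (fun x => eval_mx A x%:C%C *m weight N alpha delta x
                        *m (eval_mx B x%:C%C) ^t*%sesqui)
  = weight_form cmoment (diag_conj alpha (Lpoly R p)) (diagC N delta) A B.
Proof.
have integrandE (x : R) : eval_mx A x%:C%C *m weight N alpha delta x
      *m (eval_mx B x%:C%C) ^t*%sesqui =
    (expR (- x ^+ 2))%:C%C *: eval_mx (A *m diag_conj alpha (Lpoly R p)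
      *m cst_mx (diagC N delta) *m (map_mx (map_poly (@Num.conj C))
         (B *m diag_conj alpha (Lpoly R p)))^T) x%:C%C.
  have adjM (X Y : 'M[C]_N) :
      ((X *m Y) ^t*%sesqui) = (Y ^t*%sesqui) *m (X ^t*%sesqui).
    by rewrite trmx_mul map_mxM.
  rewrite /weight -scalemxAr -scalemxAl; congr (_ *: _).
  have := eval_Lalpha x; move: (diag_conj _ _) (Lalpha _ _ _) => Lp La eval_Lp.
  by rewrite !eval_mxM eval_conj_mx eval_mxM eval_cst_mx eval_Lp adjM !mulmxA.
apply/matrixP => i j; rewrite [LHS]mxE [RHS]mxE -integral_gauss_moment_form.
by congr Complex; apply: eq_Rintegral => x _; rewrite integrandE [in LHS]mxE
  [eval_mx _ _ _ _]mxE.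
Qed.

End GaussMoments.

(** * Consequences of the recurrences in nu *)

Section Coefficients.
Variables (R : realType) (N : nat) (alpha : nat -> R).
Hypothesis alpha_neq0 : forall k, (1 <= k <= N)%N -> alpha k != 0.

Lemma delta_stepE (delta delta' : nat -> R) (c d : R) :
  diagC N delta' = (d%:C%C *: Jmx R N + (c%:C%C)%:M) *m diagC N delta ->
  forall k, (1 <= k <= N)%N -> delta' k = (d * k%:R + c) * delta k.
Proof.
move=> Delta_rec [|k] // lt_kN.
have := congr1 (fun M : 'M[R[i]]_N => M (Ordinal lt_kN) (Ordinal lt_kN)) Delta_rec.
rewrite /Jmx /diagC mul_mx_diag !mxE eqxx !mulr1n -rmorphM -rmorphD -rmorphM.
exact: complexI.
Qed.

Definition alpha_relation (delta : nat -> R) (c d : R) :=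
  forall k, (1 <= k < N)%N -> alpha k.+1 ^+ 2 / alpha k ^+ 2 =
     (d * k%:R * (N%:R - k%:R)) / (2 * (d * k%:R + c)) * (delta k.+1 / delta k).

Lemma delta_alpha_ratio (delta : nat -> R) (c d : R) :
  (forall k, (1 <= k <= N)%N -> 0 < delta k) -> 0 < c -> 0 < d ->
  alpha_relation delta c d ->
  forall k, (1 <= k < N)%N ->
  delta k.+1 / alpha k.+1 ^+ 2 =
  delta k / alpha k ^+ 2 * (2 * (k%:R + c / d) / (k%:R * (N%:R - k%:R))).
Proof.
move=> delta_gt0 c_gt0 d_gt0 rel k /andP[k_gt0 lt_kN].
have Nk : N%:R - k%:R != 0 :> R by rewrite -natrB ?pnatr_eq0; lia.
have k0 : k%:R != 0 :> R by rewrite pnatr_eq0; lia.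
have a0 : alpha k != 0 by rewrite alpha_neq0 //; lia.
have a1 : alpha k.+1 != 0 by rewrite alpha_neq0 //; lia.
have d0 : delta k != 0 by rewrite gt_eqF // delta_gt0 //; lia.
have d1 : delta k.+1 != 0 by rewrite gt_eqF // delta_gt0 //; lia.
have dd : d != 0 by rewrite gt_eqF.
have dkc : d * k%:R + c != 0 by rewrite gt_eqF // ltr_wpDl // mulr_ge0 // ltW.
have {}rel : alpha k.+1 ^+ 2 = alpha k ^+ 2 *
    ((d * k%:R * (N%:R - k%:R)) / (2 * (d * k%:R + c)) * (delta k.+1 / delta k)).
  by rewrite -rel ?k_gt0 // mulrCA mulfV ?mulr1 // expf_neq0.
by rewrite rel; field; rewrite a0 d0 d1 Nk k0 dd dkc.
Qed.

(** The relation at k = 1 for nu and nu + 1 reads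
    d (d' + c') = d' (2 d + c), after the deltas have been eliminated. *)
Lemma kappa_step (delta delta' : nat -> R) (c d c' d' : R) :
  (1 < N)%N ->
  (forall k, (1 <= k <= N)%N -> 0 < delta k) ->
  0 < c -> 0 < d -> 0 < c' -> 0 < d' ->
  (forall k, (1 <= k <= N)%N -> delta' k = (d * k%:R + c) * delta k) ->
  alpha_relation delta c d -> alpha_relation delta' c' d' ->
  c' / d' = c / d + 1.
Proof.
move=> N_gt1 delta_gt0 c_gt0 d_gt0 c'_gt0 d'_gt0 step rel rel'.
have := rel' 1%N N_gt1; rewrite rel // (step 1%N) ?(step 2%N) //; last exact: ltnW.
rewrite !mulr1 => eq_rel.
have N1 : N%:R - 1 != 0 :> R by rewrite -(@natrB _ N 1) ?pnatr_eq0; lia.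
have d10 : delta 1%N != 0 by rewrite gt_eqF // delta_gt0 //; lia.
have d20 : delta 2%N != 0 by rewrite gt_eqF // delta_gt0 //; lia.
have dc : d + c != 0 by rewrite gt_eqF // addr_gt0.
have dc' : d' + c' != 0 by rewrite gt_eqF // addr_gt0.
have dd : d != 0 by rewrite gt_eqF.
have dd' : d' != 0 by rewrite gt_eqF.
have {}eq_rel : d * (d' + c') = d' * (d * 2 + c).
  pose z := (N%:R - 1) * (delta 2%N / delta 1%N) / (2 * (d + c) * (d' + c')).
  have z0 : z != 0.
    by rewrite !(mulf_neq0, invr_eq0) // ?invr_neq0 // !mulf_neq0 // pnatr_eq0.
  apply: (mulIf z0); transitivity
    (d * (N%:R - 1) / (2 * (d + c)) * (delta 2%N / delta 1%N)).
    by rewrite /z; field; rewrite d10 dc dc'.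
  by rewrite eq_rel /z; field; rewrite d10 dc dc'.
apply: (mulfI (mulf_neq0 dd dd')).
transitivity (d * c'); first by field; rewrite dd'.
transitivity (d' * c + d * d'); last by field; rewrite dd.
apply: (addrI (d * d')); rewrite -mulrDr eq_rel; ring.
Qed.

End Coefficients.

(** * The explicit formula *)

Lemma explicit_poly_eval (R : realType) (p : nat) (kappa : R) (alpha : nat -> R)
  (kappa_gt0 : 0 < kappa) (n : nat) (q t : 'I_p.+1) (x : R[i]) :
  eval_mx (explicit_poly p kappa alpha n) x q t =
  (alpha q.+1 / alpha t.+1 * row_scale p kappa n q)%:C%C *
  \sum_(t <= s < (minn p (n + q)).+1)
    ('i%C ^+ (s - t) * (p ^_ s)%:R / (s - t)`!%:R * (hahn p kappa n q s)%:C%C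
     * (hermite R[i] (n + q - s)).[x] * (hermite R[i] (s - t)).['i%C * x]).
Proof.
rewrite mxE diag_conjE hornerZ mxE horner_sum.
rewrite [(_ * row_scale _ _ _ _)%:C%C](rmorphM (real_complex R)) -[RHS]mulrA.
congr (_ * _); rewrite mulr_sumr big_geq_mkord.
have le_N : ((minn p (n + q)).+1 <= p.+1)%N by rewrite ltnS geq_minl.
have le_qp : (q <= p)%N by rewrite -ltnS.
rewrite (big_ord_widen_cond p.+1 (fun s => (t <= s)%N)
  (fun s => (row_scale p kappa n q)%:C%C *
    ('i%C ^+ (s - t) * (p ^_ s)%:R / (s - t)`!%:R * (hahn p kappa n q s)%:C%C
     * (hermite R[i] (n + q - s)).[x] * (hermite R[i] (s - t)).['i%C * x])) le_N).
rewrite [RHS]big_mkcond; apply: eq_bigr => s _.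
have le_sp : (s <= p)%N by rewrite -ltnS.
rewrite hornerM [hermite_rows _ _ _ _ _]mxE [Lpoly_inv _ _ _ _]mxE ltnS leq_min le_sp /=.
case: (leqP s (n + q)) => [le_s|_] /=; last by rewrite andbF horner0 mul0r.
case: (leqP t s) => [le_ts|_] /=; last by rewrite horner0 mulr0.
have eval_iX : ('i%C *: 'X).[x] = 'i%C * x by rewrite hornerZ hornerX.
rewrite [X in X * _]hornerZ [X in _ * X]hornerZ horner_comp eval_iX !horner_nhermite.
have phi_s := row_coefE kappa_gt0 le_qp le_sp le_s.
have -> : row_coef p kappa n q s =
    row_scale p kappa n q * ((p ^_ s)%:R * hahn p kappa n q s) * (n + q - s)`!%:R.
  by rewrite -phi_s mulfVK ?fact_neq0 //.
move: (row_scale _ _ _ _) (hahn _ _ _ _ _) => a b.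
rewrite !(rmorphM (real_complex R)) !(rmorph_nat (real_complex R)) /=.
move: (hermite _ _).[x] (hermite _ _).['i%C * x] => h1 h2.
by field; rewrite !fact_neq0.
Qed.

Theorem theorem3p13 (R : realType) (N : nat) (hN : (1 <= N)%N)
  (alpha : nat -> R)
  (alpha_neq0 : forall k : nat, (1 <= k <= N)%N -> alpha k != 0)
  (alpha1 : alpha 1%N = 1)
  (nu0 : R) (delta : R -> nat -> R) (c d : R -> R)
  (delta_gt0 : forall nu : R, shifts nu0 nu ->
     forall k : nat, (1 <= k <= N)%N -> 0 < delta nu k)
  (c_gt0 : forall nu : R, shifts nu0 nu -> 0 < c nu)
  (d_gt0 : forall nu : R, shifts nu0 nu -> 0 < d nu)
  (Delta_rec : forall nu : R, shifts nu0 nu ->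
     diagC N (delta (nu + 1)) =
     ((d nu)%:C%C *: Jmx R N + ((c nu)%:C%C)%:M) *m diagC N (delta nu))
  (alpha_rec : forall nu : R, shifts nu0 nu ->
     forall k : nat, (1 <= k < N)%N ->
     alpha k.+1 ^+ 2 / alpha k ^+ 2 =
     (d nu * k%:R * (N%:R - k%:R)) / (2 * (d nu * k%:R + c nu))
     * (delta nu k.+1 / delta nu k))
  (nu : R) (hnu : shifts nu0 nu)
  (P : nat -> 'M[{poly R[i]}]_N)
  (hP : monic_orthogonal (weight N alpha (delta nu)) P)
  (n : nat) (r0 t0 : 'I_N) (x : R[i]) :
  let r := r0.+1 in
  let t := t0.+1 in
  let kappa := fun k : nat => c (nu + k%:R) / d (nu + k%:R) in
  eval_mx (P n) x r0 t0 =
  (alpha r / (2 ^+ n * alpha t) * (1 / (r - 1)`!%:R)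
   * \prod_(0 <= k < n) ((1 + kappa k) / (N%:R - r%:R + 1 + kappa k)))%:C%C
  * \sum_(t <= s < (minn N (n + r)).+1)
      ('i%C ^+ (s - t) * (pochhammer (N%:R - s%:R + 1 : R) (s - 1))%:C%C
         / (s - t)`!%:R
       * (hyp3F2 (minn (s - 1) (N - r))
            (1 - s%:R) (r%:R - N%:R) (n%:R + 1 + c nu / d nu)
            (1 - N%:R) (1 + c nu / d nu) 1)%:C%C
       * (hermite R[i] (n + r - s)).[x]
       * (hermite R[i] (s - t)).['i%C * x]).
Proof.
case: N hN alpha_neq0 delta_gt0 Delta_rec alpha_rec P hP r0 t0 => // p _.
move=> alpha_neq0 delta_gt0 Delta_rec alpha_rec P [monicP orthP] q t0 r t kappa.
have shift_nu k : shifts nu0 (nu + k%:R).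
  by case: hnu => l ->; exists (l + k)%N; rewrite natrD addrA.
set kap := c nu / d nu.
have kap_gt0 : 0 < kap by rewrite divr_gt0 ?c_gt0 ?d_gt0.
have ratio := delta_alpha_ratio alpha_neq0 (delta_gt0 _ hnu) (c_gt0 _ hnu)
  (d_gt0 _ hnu) (alpha_rec _ hnu).
have -> : P n = explicit_poly p kap alpha n.
  have mu0 := gauss_moment0_gt0 R; have mu1 := gauss_moment1 R.
  have muSS := @gauss_momentSS R.
  apply: (monic_orthogonal_unique (m := fun k => (gauss_moment R k)%:C%C)
    (L := diag_conj alpha (Lpoly R p)) (W := diagC p.+1 (delta nu))) => //.
  - by move=> k; apply: monic_explicit_poly.
  - by move=> k l /orthP; rewrite integral_weight.
  - by move=> k l; apply: form_explicit_poly_orthogonal => //; apply: delta_gt0.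
  - by move=> k; apply: form_explicit_poly_unit => //; apply: delta_gt0.
have le_qp : (q <= p)%N by rewrite -ltnS.
have kap_shift k : (0 < p)%N -> kappa k = kap + k%:R.
  move=> p_gt0; elim: k => [|k IH]; first by rewrite /kappa addr0 addr0.
  have nuS : nu + k.+1%:R = nu + k%:R + 1 by rewrite -natr1 addrA.
  have := shift_nu k.+1; rewrite -natr1 addrA => sS; have s0 := shift_nu k.
  rewrite /kappa nuS addrA -IH /kappa.
  by apply: (@kappa_step R p.+1 alpha _ _ _ _ _ _ p_gt0 (delta_gt0 _ s0)
    (c_gt0 _ s0) (d_gt0 _ s0) (c_gt0 _ sS) (d_gt0 _ sS)
    (delta_stepE (Delta_rec _ s0)) (alpha_rec _ s0) (alpha_rec _ sS)).
have prodE : \prod_(0 <= k < n) ((1 + kappa k) / (p.+1%:R - r%:R + 1 + kappa k)) =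
    pochhammer (1 + kap) n / pochhammer (1 + kap + (p - q)%:R) n.
  have kap_pos k : 0 < kappa k by rewrite divr_gt0 ?c_gt0 ?d_gt0.
  have -> : p.+1%:R - r%:R = (p - q)%:R :> R by rewrite natrB // /r -!natr1; ring.
  (* for N = 1 the ratios c / d at different nu are unrelated, but each factor
     is 1 *)
  have [p0|p_gt0] := posnP p.
    have -> : (p - q = 0)%N by lia.
    rewrite addr0 divff; last by rewrite gt_eqF // poch_gt0 // addr_gt0.
    by rewrite big1 // => k _; rewrite add0r divff // gt_eqF // addr_gt0.
  rewrite /pochhammer -prodf_div; apply: eq_bigr => k _.
  by rewrite kap_shift // [X in _ / X]addrC; congr (_ / _); ring.
rewrite explicit_poly_eval // prodE; congr (_ * _).
  congr (_%:C%C); rewrite /row_scale /t /r subSS subn0 -/kap; field.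
  rewrite alpha_neq0 ?ltn_ord //= fact_neq0 expf_neq0 ?pnatr_eq0 //=.
  by rewrite gt_eqF // poch_gt0 // ltr_wpDr // addr_gt0.
have -> : (minn p.+1 (n + r)).+1 = (minn p (n + q)).+2 by rewrite /r addnS minnSS.
rewrite /t big_add1 /=; apply: eq_big_nat => s /andP[le_ts lt_s].
have le_sp : (s <= p)%N by move: lt_s; rewrite ltnS leq_min => /andP[].
rewrite /r !subSS addnS subSS subn0.
have -> : p.+1%:R - s.+1%:R = (p - s)%:R :> R by rewrite natrB // -!natr1; ring.
rewrite poch_ffact subnK // (rmorph_nat (real_complex R)).
have -> : 1 - s.+1%:R = - s%:R :> R by rewrite -natr1; ring.
have -> : q.+1%:R - p.+1%:R = - (p - q)%:R :> R by rewrite natrB // -!natr1; ring.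
have -> : 1 - p.+1%:R = - p%:R :> R by rewrite -natr1; ring.
by [].
Qed.
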